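(* Let $\mathcal{H}$ be a complex Hilbert space and $X$ a complex Banach space. (i) Let $\Phi: X\to\mathcal{H}$ be a linear map (not assumed bounded) with dense range, $T: X\to X$ a linear operator (not assumed bounded), and $N$ a bounded normal operator on $\mathcal{H}$ such that $\Phi T = N\Phi$. Then $\sigma(N)\subset\overline{\sigma(T)}$. (ii) If $\Psi:\mathcal{H}\to X$ is an injective bounded linear map, $T$ is a bounded linear operator on $X$, and $N$ is a bounded normal operator on $\mathcal{H}$ such that $\Psi N = T\Psi$, then $\sigma(N)\subset\sigma(T)$.
   Context: For a linear operator $T$ defined on all of $X$, $\sigma(T)$ is the set of $\lambda\in\mathbb{C}$ such that $T-\lambda 1: X\to X$ is not bijective (for bounded $T$ this is the usual spectrum); the bar denotes closure in $\mathbb{C}$. *)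

(* Defs.v *)
From HB Require Import structures.
From mathcomp Require Import all_boot all_order all_algebra.
From mathcomp Require Import all_classical all_reals all_analysis.
From mathcomp Require Import sesquilinear.
From mathcomp Require Export complex.

Set Implicit Arguments.
Unset Strict Implicit.
Unset Printing Implicit Defensive.

Import Order.TTheory GRing.Theory Num.Theory.
Import numFieldNormedType.Exports.

Local Open Scope classical_set_scope.
Local Open Scope complex_scope.
Local Open Scope ring_scope.

(* The norm of a normed module over [R[i]] takes its values in [R[i]]; they are
   nonnegative, hence real, for the order of the numeric field [R[i]].  The form
   [hdot] is linear in its first argument and conjugate-linear in its second. *)
HB.mixin Record NormedModule_hasInnerProduct (R : realType) H
    of NormedModule R[i] H := {
  hdot : {dot H for Num.conj};
  hdot_norm : forall x : H, hdot x x = `|x| ^+ 2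
}.

#[short(type="hilbertType")]
HB.structure Definition Hilbert (R : realType) :=
  {H of CompleteNormedModule R[i] H & NormedModule_hasInnerProduct R H}.

Definition bounded_op (K : numFieldType) (V W : normedModType K) (f : V -> W) :=
  exists M : K, forall x, `|f x| <= M * `|x|.

(* [R[i]^o] is [R[i]] with its topology as a numeric field. *)
Definition spectrum (R : realType) (V : lmodType R[i]) (T : V -> V) :
    set R[i]^o :=
  [set l | ~ bijective (fun x => T x - l *: x)].

(* An adjoint is unique; by the Riesz theorem it exists, and is linear and
   bounded, as soon as [N] is linear and bounded. *)
Definition adjoint_of (R : realType) (H : hilbertType R) (N N' : H -> H) :=
  forall x y : H, hdot (N x) y = hdot x (N' y).

Definition normal_op (R : realType) (H : hilbertType R) (N : H -> H) :=
  exists2 N' : H -> H, adjoint_of N N' & N \o N' =1 N' \o N.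

(* Main.v *)
Require Import Defs.
From HB Require Import structures.
From mathcomp Require Import all_boot all_order all_algebra.
From mathcomp Require Import all_classical all_reals all_analysis.
From mathcomp Require Import complex sesquilinear ring lra.

Set Implicit Arguments.
Unset Strict Implicit.
Unset Printing Implicit Defensive.

Import Order.TTheory GRing.Theory Num.Theory.
Import numFieldNormedType.Exports.

Local Open Scope classical_set_scope.
Local Open Scope complex_scope.
Local Open Scope ring_scope.

(** Everything rests on the spectral projections of the normal operator [N].
If [l] lies in the spectrum of [N], then for every radius [r] the spectral
projection [P] of the disc of radius [r] around [l] is nonzero, and [N - l]
maps the range of [P] into itself with norm at most [r] ([disc_proj]).

For an injective bounded [Psi] with [Psi N = T Psi]: if [T - l] were bijective,
the open mapping theorem ([bounded_inverse]) would give [q > 0] with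
[q |x| <= |(T - l) x|].  Take [r = q / 2] and a vector [v <> 0] in the range of
[P].  Then [q^n |Psi v| <= |(T - l)^n Psi v| = |Psi (N - l)^n v|], which is at
most [(q/2)^n] times a constant; so [Psi v = 0], against injectivity.

For [Phi] with dense range and [Phi T = N Phi]: if [l] is outside the closure of
the spectrum of [T], then [T - m] is bijective for every [m] in a disc around
[l], so each [y] in the range of [Phi] is of the form [(N - m)^2 h] for every such
[m], where nothing is known about the dependence of [h] on [m].  A bisection
shows that this already forces [P y = 0] ([box_no_square_range]).  Cut the box
around the disc into four; by orthogonality the spectral projection of one
quarter keeps at least half of the norm of [P y].  Iterating gives projections
[G_n] of boxes of side [r / 2^n] with [|G_n y| >= |P y| / 2^n].  The boxes
shrink to a point [m], and [y = (N - m)^2 h] yields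
[|G_n y| <= C 4^-n |h|]; the square is what makes this bound win.  Since [P] is
continuous and nonzero, it cannot vanish on the dense range of [Phi].

The spectral projections are constructed from self-adjoint operators.  Write
[N = A1 + i A2] with commuting self-adjoint parts; the disc around [c + i d] is
cut out by [(A1 - c)^2 + (A2 - d)^2], and the boxes by [A1] and [A2].  For a
self-adjoint [A >= 0] the spectral subspace of [[0, 1]] is the set [E] of vectors
with bounded orbit under the powers of [A] ([positive_cut]).  On [E] one has
[A <= 1] because [n |-> |A^n u|] is convex.  On the orthogonal complement one
has [A >= 1] because the inverses of [1 + A + ... + A^n] decrease to an operator
(the positive part of [1 - A]) whose range lies in [E].

All estimates take place in the real inner product [Re <x, y>]; operators are
functions that have an adjoint for it, which makes them additive and real
homogeneous. *)

(** * Real sequences *)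

Lemma convex_bounded_nonincreasing (R : realType) (a : nat -> R) (C : R) :
    (forall k, a k.+1 *+ 2 <= a k + a k.+2) -> (forall k, a k <= C) ->
  forall k, a k.+1 <= a k.
Proof.
move=> cvx aC k; rewrite leNgt; apply/negP => ak.
set d := a k.+1 - a k; have d0 : 0 < d by rewrite subr_gt0.
have slope j : d <= a (k + j).+1 - a (k + j)%N.
  elim: j => [|j IH]; first by rewrite addn0.
  by have := cvx (k + j)%N; rewrite addnS => h; lra.
have lin j : a k + d *+ j <= a (k + j)%N.
  elim: j => [|j IH]; first by rewrite addn0 mulr0n addr0.
  by have := slope j; rewrite addnS mulrSr => h; lra.
have [j hj] : exists j : nat, C - a k < d *+ j.
  exists (Num.bound `|(C - a k) / d|); rewrite -mulr_natr mulrC -ltr_pdivrMr//.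
  by apply: le_lt_trans (ler_norm _) _; exact: archi_boundP.
by have := lin j; have := aC (k + j)%N => h1 h2; lra.
Qed.

(** The form in which an estimate in [2 ^- n], valid for all [n], is used. *)
Lemma le0_mul_exp2 (R : realType) (a C : R) :
  (forall n : nat, a * 2 ^+ n <= C) -> a <= 0.
Proof.
move=> h; rewrite leNgt; apply/negP => a0.
have := archi_boundP (normr_ge0 (C / a)); set n := Num.bound _ => hn.
have : a * n%:R <= C.
  apply: le_trans (h n); rewrite ler_pM2l// -natrX ler_nat.
  by rewrite ltnW// ltn_expl.
rewrite leNgt => /negP; apply; rewrite mulrC -ltr_pdivrMr//.
exact: le_lt_trans (ler_norm _) hn.
Qed.

(** Choosing the left or the right half of an interval again and again leaves a
point common to all the intervals chosen. *)
Lemma nested_point (R : realType) (a : nat -> R) (r : R) : 0 < r ->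
    (forall n, a n <= a n.+1 <= a n + r / 2 ^+ n.+1) ->
  exists c, forall n, a n <= c <= a n + r / 2 ^+ n.
Proof.
move=> r0 ha.
have mono m n : (m <= n)%N -> a m <= a n /\ a n + r / 2 ^+ n <= a m + r / 2 ^+ m.
  move=> /subnK <-; elim: (n - m)%N => [//|k [h1 h2]].
  have /andP[h3 h4] := ha (k + m)%N; rewrite addSn.
  split; first exact: le_trans h1 h3.
  apply: le_trans h2.
  have -> : r / 2 ^+ (k + m) = r / 2 ^+ (k + m).+1 + r / 2 ^+ (k + m).+1.
    by rewrite exprS; field; rewrite expf_neq0.
  by rewrite addrA lerD2r.
pose D : set R := range a.
have pos n : 0 <= r / 2 ^+ n by rewrite divr_ge0 ?exprn_ge0 ?(ltW r0).
have cross m n : a m <= a n + r / 2 ^+ n.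
  have [/mono[h _]|/ltnW/mono[_ h]] := leqP m n.
    by apply: le_trans h _; rewrite lerDl.
  by apply: le_trans h; rewrite lerDl.
have Dsup : has_sup D.
  split; first by exists (a 0%N); exists 0%N.
  by exists (a 0%N + r / 2 ^+ 0) => _ [m _ <-].
exists (sup D) => n; apply/andP; split.
  by apply: sup_upper_bound => //; exists n.
by apply: ge_sup => [|_ [m _ <-]] //; exact: Dsup.1.
Qed.

(** * Real norm and real inner product *)

Lemma gt0_real_complex (R : realType) (e : R[i]) :
  0 < e -> exists2 r : R, 0 < r & e = r%:C.
Proof.
rewrite ltcE => /andP[/eqP/= ie re]; exists (complex.Re e) => //.
by move: ie; case: (e) => a b /= ->.
Qed.

Section RealNorm.
Variables (R : realType) (V : normedModType R[i]).
Implicit Types (x y : V) (r : R).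

Definition nrm x : R := complex.Re `|x|.

Lemma nrmE x : `|x| = (nrm x)%:C.
Proof.
have := normr_ge0 x; rewrite /nrm lecE => /andP[/eqP/= + _].
by case: `|x| => a b /= ->.
Qed.

Lemma nrm_ge0 x : 0 <= nrm x.
Proof. by rewrite -ler0c -nrmE normr_ge0. Qed.

Lemma nrm0_eq0 x : nrm x = 0 -> x = 0.
Proof. by move=> h; apply: normr0_eq0; rewrite nrmE h. Qed.

Lemma nrm0 : nrm 0 = 0.
Proof. by rewrite /nrm normr0. Qed.

Lemma nrmN x : nrm (- x) = nrm x.
Proof. by rewrite /nrm normrN. Qed.

Lemma nrmD x y : nrm (x + y) <= nrm x + nrm y.
Proof. by rewrite -lecR rmorphD/= -!nrmE ler_normD. Qed.

Lemma nrmB x y : nrm (x - y) <= nrm x + nrm y.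
Proof. by rewrite -[nrm y]nrmN; exact: nrmD. Qed.

Lemma nrmZr r x : nrm (r%:C *: x) = `|r| * nrm x.
Proof.
apply: complexI; rewrite -nrmE normrZ rmorphM/= -nrmE normc_def/=.
by rewrite expr0n/= addr0 sqrtr_sqr.
Qed.

Lemma nrmZi x : nrm ('i *: x) = nrm x.
Proof.
apply: complexI; rewrite -nrmE normrZ normc_def/=.
by rewrite expr0n/= expr1n add0r sqrtr1 mul1r -nrmE.
Qed.

(** Convergence measured by the real norm, to stay clear of the order of
[R[i]]. *)
Definition tends (u : nat -> V) l :=
  forall e : R, 0 < e -> exists N, forall n, (N <= n)%N -> nrm (u n - l) < e.

End RealNorm.

Lemma nrm_cauchy_tends (R : realType) (V : completeNormedModType R[i])
    (u : nat -> V) :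
  (forall e : R, 0 < e ->
    exists N, forall m n, (N <= m)%N -> (N <= n)%N -> nrm (u m - u n) < e) ->
  exists l, tends u l.
Proof.
move=> uc.
have : cvgn u.
  apply/cauchy_cvgP/cauchy_ballP => e /gt0_real_complex[r r0 ->].
  have [N uN] := uc r r0; near_simpl.
  exists ([set n | (N <= n)%N], [set n | (N <= n)%N]); first by split; exists N.
  case=> m n [/= Nm Nn]; rewrite -ball_normE/= nrmE ltcR; exact: uN.
move=> /cvg_ex[l ul]; exists l => e e0.
move/cvgrPdist_lt : ul => /(_ e%:C).
rewrite ltcR => /(_ e0)[N _ hN]; exists N => n Nn.
by have := hN n Nn => /=; rewrite nrmE ltcR -nrmN opprB.
Qed.

Section InnerProduct.
Variables (R : realType) (H : hilbertType R).
Implicit Types (x y z : H) (r : R).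

Definition ip x y : R := complex.Re (hdot x y).

Lemma hdotC x y : hdot x y = (hdot y x)^*%C.
Proof. by rewrite hermC/= expr0 mul1r. Qed.

Lemma ipC x y : ip x y = ip y x.
Proof. by rewrite /ip hdotC; case: (hdot y x). Qed.

Lemma ipDl x y z : ip (x + y) z = ip x z + ip y z.
Proof. by rewrite /ip linearDl/= raddfD. Qed.

Lemma ipDr x y z : ip z (x + y) = ip z x + ip z y.
Proof. by rewrite ipC ipDl !(ipC _ z). Qed.

Lemma ipNl x y : ip (- x) y = - ip x y.
Proof. by rewrite /ip linearNl/= raddfN. Qed.

Lemma ipNr x y : ip x (- y) = - ip x y.
Proof. by rewrite ipC ipNl ipC. Qed.

Lemma ipBl x y z : ip (x - y) z = ip x z - ip y z.
Proof. by rewrite ipDl ipNl. Qed.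

Lemma ipBr x y z : ip z (x - y) = ip z x - ip z y.
Proof. by rewrite ipDr ipNr. Qed.

Lemma ipZl r x y : ip (r%:C *: x) y = r * ip x y.
Proof.
rewrite /ip linearZl_LR/=; case: (hdot x y) => a b /=.
by rewrite mul0r subr0.
Qed.

Lemma ipZr r x y : ip x (r%:C *: y) = r * ip x y.
Proof. by rewrite ipC ipZl ipC. Qed.

Lemma ip0l x : ip 0 x = 0.
Proof. by rewrite -[0](subrr 0) ipBl subrr. Qed.

Lemma ip0r x : ip x 0 = 0.
Proof. by rewrite ipC ip0l. Qed.

Lemma ip_sq x : ip x x = nrm x ^+ 2.
Proof. by rewrite /ip hdot_norm nrmE -rmorphXn. Qed.

Lemma ip_ge0 x : 0 <= ip x x.
Proof. by rewrite ip_sq sqr_ge0. Qed.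

Lemma ip_eq0 x : ip x x = 0 -> x = 0.
Proof.
by rewrite ip_sq => /eqP; rewrite sqrf_eq0 => /eqP; exact: nrm0_eq0.
Qed.

Lemma ip_le x y : ip x x <= ip y y -> nrm x <= nrm y.
Proof. by rewrite !ip_sq ler_sqr // nnegrE nrm_ge0. Qed.

Lemma ip_leM c x y :
  0 <= c -> ip x x <= c ^+ 2 * ip y y -> nrm x <= c * nrm y.
Proof.
move=> c0; rewrite !ip_sq -exprMn => h.
by rewrite -ler_sqr ?nnegrE ?nrm_ge0 ?mulr_ge0 ?nrm_ge0.
Qed.

Lemma ipZil x y : ip ('i *: x) y = - ip x ('i *: y).
Proof.
rewrite /ip linearZl_LR linearZr_LR/=; case: (hdot x y) => a b /=.
by ring.
Qed.

Lemma ipZir x y : ip x ('i *: y) = - ip ('i *: x) y.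
Proof. by rewrite ipZil opprK. Qed.

Lemma ip_normD x y : ip (x + y) (x + y) = ip x x + ip x y *+ 2 + ip y y.
Proof. by rewrite !ipDl !ipDr (ipC y x); ring. Qed.

Lemma ip_normB x y : ip (x - y) (x - y) = ip x x - ip x y *+ 2 + ip y y.
Proof. by rewrite ip_normD ipNl !ipNr opprK mulNrn. Qed.

Lemma cauchy_schwarz x y : `|ip x y| <= nrm x * nrm y.
Proof.
rewrite -ler_sqr ?nnegrE ?mulr_ge0 ?nrm_ge0 // real_normK ?num_real//.
have [y0|y0] := eqVneq (ip y y) 0.
  by rewrite (ip_eq0 y0) ip0r nrm0 mulr0.
have yy : 0 < ip y y by rewrite lt0r y0 ip_ge0.
have := ip_ge0 ((ip y y)%:C *: x - (ip x y)%:C *: y).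
rewrite ip_normB !ipZl !ipZr exprMn -!ip_sq.
move=> h; have : 0 <= ip y y * (ip x x * ip y y - ip x y ^+ 2) by lra.
by rewrite pmulr_rge0 // subr_ge0.
Qed.

Lemma ip_le_nrm x y : ip x y <= nrm x * nrm y.
Proof. exact: le_trans (ler_norm _) (cauchy_schwarz x y). Qed.

End InnerProduct.

(** * Limits *)

Section Limits.
Variables (R : realType) (H : hilbertType R).
Implicit Types (x y z : H) (r : R) (u : nat -> H).

Lemma tends_nrmB u l : tends u l -> (fun n => nrm (u n - l)) @ \oo --> (0 : R).
Proof.
move=> ul; apply/cvgr0Pnorm_lt => e /ul[N uN].
by exists N => // n /= /uN; rewrite ger0_norm ?nrm_ge0.
Qed.

Lemma tends_ip u l y : tends u l -> (fun n => ip (u n) y) @ \oo --> ip l y.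
Proof.
move=> /tends_nrmB ul; apply/subr_cvg0; apply/norm_cvg0P.
have h : (fun n => nrm (u n - l) * nrm y) @ \oo --> (0 : R).
  by rewrite -(mul0r (nrm y)); apply: cvgMl.
apply: (squeeze_cvgr _ (cvg_cst 0) h); near=> n.
by rewrite normr_ge0/= -ipBl; exact: cauchy_schwarz.
Unshelve. all: by end_near. Qed.

(** A one-sided Lipschitz bound is all that is needed for an upper bound to
survive the limit; it applies to norms and to differences of norms. *)
Lemma tends_le u l (f : H -> R) (K c : R) :
    (forall x y, f x <= f y + K * nrm (x - y)) ->
  tends u l -> (forall n, f (u n) <= c) -> f l <= c.
Proof.
move=> fK /tends_nrmB ul fc.
have h : (fun n => c + K * nrm (u n - l)) @ \oo --> c.
  by rewrite -[X in _ --> X]addr0 -[X in c + X](mulr0 K);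
     apply: cvgD; [exact: cvg_cst|apply: cvgMr].
apply: (ler_cvg_to (cvg_cst (f l)) h); near=> n.
apply: le_trans (fK l (u n)) _.
by rewrite -(nrmN (l - _)) opprB lerD2r.
Unshelve. all: by end_near. Qed.

Lemma ip_inj x y : (forall z, ip x z = ip y z) -> x = y.
Proof.
move=> xy; apply/eqP; rewrite -subr_eq0; apply/eqP/ip_eq0.
by rewrite ipBl xy subrr.
Qed.

Lemma nrm_lip x y : nrm x <= nrm y + nrm (x - y).
Proof. by apply: le_trans (nrmD _ _); rewrite addrC subrK. Qed.

Lemma tends_uniq u l l' : tends u l -> tends u l' -> l = l'.
Proof.
move=> ul ul'; apply: ip_inj => y.
rewrite -(cvg_lim (@Rhausdorff R) (@tends_ip u l y ul)).
by rewrite (cvg_lim (@Rhausdorff R) (@tends_ip u l' y ul')).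
Qed.

End Limits.

(** * Operators with an adjoint, orthogonal projections *)

Section Operators.
Variables (R : realType) (H : hilbertType R).
Implicit Types (x y z : H) (r : R) (f g A B P : H -> H).

Definition adjoint f g := forall x y, ip (f x) y = ip x (g y).

Definition bdd f := exists2 M : R, 0 <= M & forall x, nrm (f x) <= M * nrm x.

Lemma adjoint_sym f g : adjoint f g -> adjoint g f.
Proof. by move=> fg x y; rewrite ipC -fg ipC. Qed.

(** Having an adjoint forces additivity, and real homogeneity below, because
the form is nondegenerate. *)
Lemma adjointD f g : adjoint f g -> {morph f : x y / x + y}.
Proof. by move=> fg x y; apply: ip_inj => z; rewrite ipDl !fg ipDl. Qed.

Lemma adjointZ f g r : adjoint f g -> {morph f : x / r%:C *: x}.
Proof. by move=> fg x; apply: ip_inj => z; rewrite ipZl !fg ipZl. Qed.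

Lemma adjointN f g : adjoint f g -> {morph f : x / - x}.
Proof. by move=> fg x; apply: ip_inj => z; rewrite ipNl !fg ipNl. Qed.

Lemma adjointB f g : adjoint f g -> {morph f : x y / x - y}.
Proof. by move=> fg x y; rewrite (adjointD fg) (adjointN fg). Qed.

Lemma adjoint0 f g : adjoint f g -> f 0 = 0.
Proof. by move=> fg; apply: ip_inj => z; rewrite fg !ip0l. Qed.

Lemma adjoint_iter f g n : adjoint f g -> adjoint (iter n f) (iter n g).
Proof.
move=> fg; elim: n => [//|n IH] x y.
by rewrite iterS fg IH -iterSr.
Qed.

(** [|g x|^2 = <f (g x), x>]. *)
Lemma adjoint_bdd f g : adjoint f g -> bdd f -> bdd g.
Proof.
move=> fg [M M0 fM]; exists M => // x.
have [->|gx0] := eqVneq (nrm (g x)) 0; first by rewrite mulr_ge0 ?nrm_ge0.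
have gx : 0 < nrm (g x) by rewrite lt0r gx0 nrm_ge0.
rewrite -(ler_pM2l gx) -expr2 -ip_sq -fg.
apply: le_trans (ip_le_nrm _ _) _.
by rewrite mulrCA mulrA ler_wpM2r ?nrm_ge0.
Qed.

Lemma bdd_comp f g : bdd f -> bdd g -> bdd (f \o g).
Proof.
move=> [M M0 fM] [K K0 gK]; exists (M * K); first exact: mulr_ge0.
by move=> x /=; apply: le_trans (fM _) _; rewrite -mulrA ler_wpM2l.
Qed.

Lemma bdd_iter f n : bdd f -> bdd (iter n f).
Proof.
move=> fb; elim: n => [|n]; first by exists 1 => // x; rewrite mul1r.
exact: bdd_comp.
Qed.

Lemma bddD f g : bdd f -> bdd g -> bdd (fun x => f x + g x).
Proof.
move=> [M M0 fM] [K K0 gK]; exists (M + K); first exact: addr_ge0.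
by move=> x; apply: le_trans (nrmD _ _) _; rewrite mulrDl lerD.
Qed.

Lemma bddZ r f : bdd f -> bdd (fun x => r%:C *: f x).
Proof.
move=> [M M0 fM]; exists (`|r| * M); first by rewrite mulr_ge0.
by move=> x; rewrite nrmZr -mulrA ler_wpM2l.
Qed.

Lemma bdd_id : bdd id.
Proof. by exists 1 => // x; rewrite mul1r. Qed.

Lemma bdd_tends f g u l : adjoint f g -> bdd f -> tends u l -> tends (f \o u) (f l).
Proof.
move=> fg [M M0 fM] ul e e0.
have M1 : 0 < M + 1 by rewrite ltr_wpDl.
have [N uN] := ul (e / (M + 1)) (divr_gt0 e0 M1).
exists N => n /uN h; rewrite /= -(adjointB fg).
apply: le_lt_trans (fM _) _; apply: (@le_lt_trans _ _ ((M + 1) * nrm (u n - l))).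
  by rewrite ler_wpM2r ?nrm_ge0// lerDl.
by rewrite mulrC -ltr_pdivlMr.
Qed.

Record closed_subspace (E : H -> Prop) : Prop := ClosedSubspace {
  csub0 : E 0;
  csubD : forall x y, E x -> E y -> E (x + y);
  csubZ : forall r x, E x -> E (r%:C *: x);
  csub_lim : forall u l, (forall n, E (u n)) -> tends u l -> E l }.

(** A minimizing sequence for the distance to [x] is Cauchy by the parallelogram
law.  Orthogonality is proved along the sequence: a vector at squared distance
less than [d + delta] is orthogonal up to [delta], since moving it along [y]
cannot bring the squared distance below the infimum [d]. *)
Lemma exists_nearest E x : closed_subspace E ->
  exists2 e, E e & forall y, E y -> ip (x - e) y = 0.
Proof.
move=> cE; pose D : set R := [set ip (x - e) (x - e) | e in [set e | E e]].
have Dinf : has_inf D.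
  split; first by exists (ip (x - 0) (x - 0)); exists 0 => //; exact: csub0 cE.
  by exists 0 => _ [e _ <-]; exact: ip_ge0.
pose d : R := inf D.
have dE e : E e -> d <= ip (x - e) (x - e) :> R.
  by move=> Ee; apply: ge_inf Dinf.2 _ _; exists e.
have h_gt0 n : 0 < harmonic n :> R by exact: harmonic_gt0.
have ex n : exists e, E e /\ ip (x - e) (x - e) < d + harmonic n.
  have [_ [e Ee <-] he] := inf_adherent (h_gt0 n) Dinf.
  by exists e.
have [u uP] := choice ex.
have par a b : E a -> E b ->
    ip (a - b) (a - b) <= ip (x - a) (x - a) *+ 2 + ip (x - b) (x - b) *+ 2 - d *+ 4.
  move=> Ea Eb; have := dE _ (csubZ cE (2^-1) (csubD cE Ea Eb)).
  rewrite !ip_normB !ipZr !ipZl ip_normD ipDr => h. lra.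
have /nrm_cauchy_tends[e ue] : forall eps : R, 0 < eps -> exists N, forall m n,
    (N <= m)%N -> (N <= n)%N -> nrm (u m - u n) < eps.
  move=> eps eps0; have e2 : 0 < eps ^+ 2 / 4 by rewrite divr_gt0 ?exprn_gt0.
  have /cvgr0Pnorm_lt/(_ _ e2)[N _ hN] := @cvg_harmonic R.
  exists N => m n Nm Nn; rewrite -ltr_sqr ?nnegrE ?nrm_ge0 ?ltW// -ip_sq.
  apply: le_lt_trans (par _ _ (uP m).1 (uP n).1) _.
  have hk k : (N <= k)%N -> (harmonic k : R) < eps ^+ 2 / 4.
    by move=> /hN; rewrite (gtr0_norm (h_gt0 k)).
  move: (hk m Nm) (hk n Nn) (uP m).2 (uP n).2.
  by move: (harmonic m) (harmonic n) => p q h1 h2 h3 h4; lra.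
exists e => [|y Ey]; first by apply: (csub_lim cE _ ue) => n; exact: (uP n).1.
have near_orth n : ip (x - u n) y ^+ 2 <= ip y y * harmonic n.
  have [y0|y0] := eqVneq (ip y y) 0.
    by rewrite (ip_eq0 y0) !ip0r expr0n mul0r.
  have yy : 0 < ip y y by rewrite lt0r y0 ip_ge0.
  (* The step [t] along [y] that minimizes the distance to [x]. *)
  pose t := ip (x - u n) y / ip y y.
  have := dE _ (csubD cE (uP n).1 (csubZ cE t Ey)).
  rewrite opprD addrA (ip_normB (x - u n)) ipZr ipZl ipZr => h.
  have tE : t * ip y y = ip (x - u n) y by rewrite /t divfK.
  have : t * ip (x - u n) y <= harmonic n.
    have := (uP n).2; move: h; rewrite tE => h1 h2; lra.
  by rewrite -(ler_pM2l yy) mulrA (mulrC (ip y y) t) tE -expr2.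
have lim1 : (fun n => ip (x - u n) y ^+ 2) @ \oo --> ip (x - e) y ^+ 2.
  have c : (fun n => ip (x - u n) y) @ \oo --> ip (x - e) y.
    under eq_fun do rewrite ipBl; rewrite ipBl.
    by apply: cvgB; [exact: cvg_cst|exact: tends_ip].
  by under eq_fun do rewrite expr2; rewrite expr2; apply: cvgM.
have lim2 : (fun n => ip y y * harmonic n) @ \oo --> (0 : R).
  by rewrite -(mulr0 (ip y y)); apply: cvgMr; exact: cvg_harmonic.
have : ip (x - e) y ^+ 2 <= 0.
  by apply: (ler_cvg_to lim1 lim2); near=> n; exact: near_orth.
by rewrite le_eqVlt ltNge sqr_ge0 orbF sqrf_eq0 => /eqP.
Unshelve. all: by end_near. Qed.

Record orth_proj P : Prop := OrthProj {
  proj_adjoint : adjoint P P;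
  proj_idem : forall x, P (P x) = P x }.

(** The last clause is how projections inherit commutation: an operator that
preserves [E] together with its adjoint also preserves the complement. *)
Lemma exists_proj E : closed_subspace E ->
  exists P, [/\ orth_proj P, forall x, E (P x),
    forall x y, E y -> ip (x - P x) y = 0 &
    forall B B', adjoint B B' -> (forall x, E x -> E (B x)) ->
      (forall x, E x -> E (B' x)) -> forall x, P (B x) = B (P x)].
Proof.
move=> cE.
have ex x : exists e, E e /\ forall y, E y -> ip (x - e) y = 0.
  by have [e] := exists_nearest x cE; exists e.
have [P PP] := choice ex; exists P.
have PE x : E (P x) := (PP x).1.
have PO x y : E y -> ip (x - P x) y = 0 := (PP x).2 y.
have uniq x e : E e -> (forall y, E y -> ip (x - e) y = 0) -> P x = e.
  move=> Ee eO; apply/eqP; rewrite -subr_eq0; apply/eqP/ip_eq0.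
  have Ed : E (P x - e).
    rewrite -(scaleN1r e) -(rmorphN1 (real_complex R)).
    exact: (csubD cE (PE x) (csubZ cE (-1) Ee)).
  have := PO x _ Ed; have := eO _ Ed; rewrite ip_normB !ipBl !ipBr.
  by rewrite (ipC e (P x)) => h1 h2; lra.
split=> //.
- split=> [x y|x]; last by apply: uniq => // y _; rewrite subrr ip0l.
  have := PO x _ (PE y); have := PO y _ (PE x).
  by rewrite !ipBl (ipC (P y)) (ipC y) => h1 h2; lra.
- move=> B B' BB' EB EB' x; apply: uniq; first exact/EB/PE.
  by move=> y Ey; rewrite -(adjointB BB') BB'; apply/PO/EB'.
Qed.

Lemma proj_split P x : orth_proj P ->
  ip x x = ip (P x) (P x) + ip (x - P x) (x - P x).
Proof.
move=> [PP PI]; rewrite ip_normB.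
have -> : ip x (P x) = ip (P x) (P x) by rewrite PP PI.
by lra.
Qed.

Lemma proj_nrm P x : orth_proj P -> nrm (P x) <= nrm x.
Proof. by move=> PP; apply: ip_le; rewrite (proj_split x PP) lerDl ip_ge0. Qed.

Lemma proj_bdd P : orth_proj P -> bdd P.
Proof. by move=> PP; exists 1 => // x; rewrite mul1r proj_nrm. Qed.

Lemma projC P : orth_proj P -> orth_proj (fun x => x - P x).
Proof.
move=> [PP PI]; split=> [x y|x]; first by rewrite ipBl ipBr PP.
by rewrite (adjointB PP) PI subrr subr0.
Qed.

(** A lower bound makes the range closed, and the vectors orthogonal to the
range are killed by the adjoint. *)
Lemma bounded_below_surj f g c : adjoint f g -> bdd f -> 0 < c ->
  (forall x, c * nrm x <= nrm (f x)) -> (forall x, g x = 0 -> x = 0) ->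
  forall y, exists x, f x = y.
Proof.
move=> fg bf c0 fc g0 y; pose E z := exists x, f x = z.
have cE : closed_subspace E.
  split.
  - by exists 0; exact: adjoint0 fg.
  - by move=> _ _ [x <-] [x' <-]; exists (x + x'); exact: (adjointD fg).
  - by move=> r _ [x <-]; exists (r%:C *: x); exact: (adjointZ r fg).
  - move=> u l Eu ul; have [v vE] := choice Eu.
    have /nrm_cauchy_tends[x vx] : forall eps : R, 0 < eps ->
        exists N, forall m n, (N <= m)%N -> (N <= n)%N -> nrm (v m - v n) < eps.
      move=> eps eps0.
      have [N uN] := ul (c * (eps / 2)) (mulr_gt0 c0 (divr_gt0 eps0 (ltr0Sn _ 1))).
      exists N => m n /uN hm /uN hn; rewrite -(ltr_pM2l c0).
      apply: le_lt_trans (fc _) _; rewrite (adjointB fg) !vE.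
      have -> : u m - u n = (u m - l) - (u n - l) by rewrite opprB addrA subrK.
      apply: le_lt_trans (nrmB _ _) _.
      by rewrite [eps]splitr mulrDr ltrD.
    exists x; apply: tends_uniq ul.
    rewrite (_ : u = f \o v); first exact: bdd_tends fg bf vx.
    by apply/funext => n /=; rewrite vE.
have [P [PP EP PO _]] := exists_proj cE.
have /g0/eqP : g (y - P y) = 0.
  by apply/ip_eq0; rewrite -fg ipC; apply: PO; exists (g (y - P y)).
by rewrite subr_eq0 => /eqP yP; have [x fx] := EP y; exists x; rewrite fx.
Qed.

End Operators.

(** * Cutting a positive operator at 1 *)

Section PositiveCut.
Variables (R : realType) (H : hilbertType R) (A : H -> H).
Hypotheses (AA : adjoint A A) (bA : bdd A) (pA : forall x, 0 <= ip (A x) x).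
Implicit Types (x y z u : H) (f g : H -> H).

(** The polynomials in [A] with natural coefficients.  They commute and are
nonnegative, so an inequality between polynomials in [A] follows once the
difference has nonnegative coefficients. *)
Inductive cone : (H -> H) -> Prop :=
| cone0 : cone (fun=> 0)
| cone1 : cone id
| coneA f : cone f -> cone (A \o f)
| coneD f g : cone f -> cone g -> cone (fun x => f x + g x).

Lemma cone_commA f : cone f -> forall x, f (A x) = A (f x).
Proof.
elim=> {f} [x|//|f _ IH x|f g _ IHf _ IHg x] /=.
- by rewrite (adjoint0 AA).
- by rewrite IH.
- by rewrite IHf IHg (adjointD AA).
Qed.

Lemma cone_adjoint f : cone f -> adjoint f f.
Proof.
elim=> {f} [x y|//|f cf IH x y|f g _ IHf _ IHg x y] /=.
- by rewrite ip0l ip0r.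
- by rewrite AA IH cone_commA.
- by rewrite ipDl ipDr IHf IHg.
Qed.

Lemma cone_bdd f : cone f -> bdd f.
Proof.
elim=> {f} [||f _ bf|f g _ bf _ bg].
- by exists 0 => // x; rewrite nrm0 mul0r.
- exact: bdd_id.
- exact: bdd_comp.
- exact: bddD.
Qed.

(** Odd powers of [A] force the induction to carry [A \o f] along:
[<A (A f x), x> = <f (A x), A x>]. *)
Lemma cone_ge0 f x : cone f -> 0 <= ip (f x) x.
Proof.
move=> cf; suff [] : (forall x, 0 <= ip (f x) x) /\
  (forall x, 0 <= ip (A (f x)) x) by [].
elim: cf => {x f} [||f cf [IH IHA]|f g _ [IHf IHAf] _ [IHg IHAg]] /=.
- by split=> x; rewrite ?(adjoint0 AA) ip0l.
- by split=> // x; exact: ip_ge0.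
- by split=> // x; rewrite AA -cone_commA.
- by split=> x; rewrite ?(adjointD AA) ipDl addr_ge0.
Qed.

Lemma cone_comp f g : cone f -> cone g -> cone (f \o g).
Proof.
move=> cf cg; elim: cf => {f} [||f _ IH|f h _ IHf _ IHh].
- exact: cone0.
- exact: cg.
- exact: (coneA IH).
- exact: (coneD IHf IHh).
Qed.

Lemma cone_comm f g x : cone f -> cone g -> f (g x) = g (f x).
Proof.
move=> cf cg; elim: cf x => {f} [x|//|f _ IH x|f h _ IHf _ IHh x] /=.
- by rewrite (adjoint0 (cone_adjoint cg)).
- by rewrite IH cone_commA.
- by rewrite IHf IHh (adjointD (cone_adjoint cg)).
Qed.

Lemma cone_ip_ge0 f g x : cone f -> cone g -> 0 <= ip (f x) (g x).
Proof.
move=> cf cg; rewrite ipC -(cone_adjoint cf) ipC ipC.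
exact: (cone_ge0 x (cone_comp cf cg)).
Qed.

Lemma cone_iter n : cone (iter n A).
Proof. by elim: n => [|n IH]; [exact: cone1|exact: coneA IH]. Qed.

(** The sum [1 + A + ... + A^n]. *)
Fixpoint geom n : H -> H :=
  if n is m.+1 then fun x => geom m x + iter m.+1 A x else id.

Lemma cone_geom n : cone (geom n).
Proof.
elim: n => [|n IH]; first exact: cone1.
exact: coneD IH (cone_iter n.+1).
Qed.

Lemma geom_diff m n : (m <= n)%N ->
  exists2 D, cone D & forall x, geom n x = geom m x + D x.
Proof.
move=> /subnK <-; elim: (n - m)%N => [|k [D cD DE]].
  by exists (fun=> 0); [exact: cone0|move=> x; rewrite addr0].
exists (fun x => D x + iter (k + m).+1 A x); first exact: coneD cD (cone_iter _).
by move=> x; rewrite addSn addrA -DE.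
Qed.

Lemma geom_iter m n : (m <= n)%N ->
  exists2 Q, cone Q & forall x, geom n x = iter m A x + Q x.
Proof.
move=> /geom_diff[D cD DE]; case: m DE => [|m] DE; first by exists D.
exists (fun x => geom m x + D x); first exact: coneD (cone_geom m) cD.
by move=> x; rewrite DE /= -addrA addrCA.
Qed.

Lemma geom_telescope n x : A (geom n x) + x = geom n x + iter n.+1 A x.
Proof.
elim: n => [|n IH] /=; first by rewrite addrC.
by rewrite (adjointD AA) addrAC IH.
Qed.

Lemma nrm_iter_le_geom m n x : (m <= n)%N -> nrm (iter m A x) <= nrm (geom n x).
Proof.
move=> /geom_iter[Q cQ QE]; apply: ip_le; rewrite QE ip_normD.
have := cone_ip_ge0 x (cone_iter m) cQ; have := ip_ge0 (Q x) => h1 h2; lra.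
Qed.

Lemma geom_surj n u : exists x, geom n x = u.
Proof.
have gn := cone_adjoint (cone_geom n).
apply: (bounded_below_surj gn (cone_bdd (cone_geom n)) ltr01) => [x|x gx0].
  by rewrite mul1r; exact: (nrm_iter_le_geom x (leq0n n)).
apply: nrm0_eq0; apply/le_anti; rewrite nrm_ge0 andbT.
by have := nrm_iter_le_geom x (leq0n n); rewrite gx0 nrm0.
Qed.

(** With [S_n = geom n], the difference [S_m^-1 - S_n^-1] is nonnegative and
dominates its own square.  Writing [s = S_m x] turns everything into polynomials
in [A] applied to [x]: [u = S_m S_n x] and [t - s = (S_n - S_m) x], where both
[S_n - S_m] and [S_m S_n - (S_n - S_m)] have nonnegative coefficients. *)
Lemma geom_inv_diff m n u t s : (m <= n)%N -> geom m t = u -> geom n s = u ->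
  ip (t - s) (t - s) <= ip t u - ip s u.
Proof.
move=> mn tu su; have [D cD DE] := geom_diff mn.
have [Q cQ QE] := geom_iter (leq0n m).
have [x xs] := geom_surj m s.
have ux : u = geom m (geom n x).
  by rewrite (cone_comm _ (cone_geom m) (cone_geom n)) xs.
have tx : t = geom n x.
  have gm := cone_adjoint (cone_geom m).
  apply/eqP; rewrite -subr_eq0; apply/eqP/nrm0_eq0/le_anti.
  rewrite nrm_ge0 andbT; apply: le_trans (nrm_iter_le_geom _ (leq0n m)) _.
  by rewrite (adjointB gm) tu -ux subrr nrm0.
rewrite -ipBl; have -> : t - s = D x by rewrite tx -xs DE addrC addKr.
have -> : u = D x + (geom m x + Q (geom n x)).
  rewrite ux [LHS]QE /= DE; set a := Q _.
  by rewrite addrA; congr (_ + _); exact: addrC.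
rewrite ipDr lerDl ipDr addr_ge0//; first exact: cone_ip_ge0 cD (cone_geom m).
exact: (cone_ip_ge0 x cD (cone_comp cQ (cone_geom n))).
Qed.

(** The real numbers [<S_n^-1 u, u>] decrease and control the increments of
[S_n^-1 u], so these vectors converge. *)
Lemma geom_inv_cvg u : exists t w,
  (forall n, geom n (t n) = u) /\ tends t w.
Proof.
have [t tu] := choice (geom_surj ^~ u).
have a_ge0 n : 0 <= ip (t n) u.
  by rewrite -(tu n) ipC; exact: (cone_ge0 _ (cone_geom n)).
pose D : set R := range (fun n => ip (t n) u).
have Dinf : has_inf D.
  split; first by exists (ip (t 0%N) u); exists 0%N.
  by exists 0 => _ [n _ <-].
have step m n : (m <= n)%N ->
    ip (t m - t n) (t m - t n) <= ip (t m) u - inf D.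
  move=> mn; apply: le_trans (geom_inv_diff mn (tu m) (tu n)) _.
  by rewrite lerD2l lerN2; apply: ge_inf Dinf.2 _ _; exists n.
exists t; have /nrm_cauchy_tends[w tw] : forall eps : R, 0 < eps ->
    exists N, forall m n, (N <= m)%N -> (N <= n)%N -> nrm (t m - t n) < eps.
  move=> eps eps0; have e2 : 0 < (eps / 2) ^+ 2 by rewrite exprn_gt0 ?divr_gt0.
  have [_ [N _ <-] hN] := inf_adherent e2 Dinf.
  have near n : (N <= n)%N -> nrm (t N - t n) < eps / 2.
    move=> Nn; rewrite -ltr_sqr ?nnegrE ?nrm_ge0 ?divr_ge0 ?ltW// -ip_sq.
    by apply: le_lt_trans (step _ _ Nn) _; rewrite ltrBlDl.
  exists N => m n Nm Nn.
  have -> : t m - t n = (t N - t n) - (t N - t m).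
    by rewrite opprB [RHS]addrC addrA subrK.
  by apply: le_lt_trans (nrmB _ _) _; rewrite [eps]splitr ltrD ?near.
by exists w.
Qed.

Definition power_bounded u := exists C, forall n, nrm (iter n A u) <= C.

(** As [A] is self-adjoint, [|A^(k+1) u|^2 <= |A^k u| |A^(k+2) u|]; hence the norms
are convex in [k], and a bounded convex sequence cannot increase. *)
Lemma power_bounded_le u n : power_bounded u -> nrm (iter n A u) <= nrm u.
Proof.
move=> [C uC]; elim: n => [//|n IH]; apply: le_trans IH.
apply: (@convex_bounded_nonincreasing _ (fun k => nrm (iter k A u)) C) => // k.
set a := nrm (iter k.+1 A u).
have a0 : 0 <= a := nrm_ge0 _.
have logc : a ^+ 2 <= nrm (iter k A u) * nrm (iter k.+2 A u).
  rewrite -ip_sq [X in ip X _]iterS AA; exact: ip_le_nrm.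
rewrite -ler_sqr ?nnegrE ?mulrn_wge0 ?addr_ge0 ?nrm_ge0//.
have := sqr_ge0 (nrm (iter k A u) - nrm (iter k.+2 A u)).
move: logc; move: (nrm (iter k A u)) (nrm (iter k.+2 A u)) => b c h1 h2.
nra.
Qed.

(** Closedness needs the bound of [power_bounded_le], which is uniform. *)
Lemma power_bounded_closed : closed_subspace power_bounded.
Proof.
split.
- by exists 0 => n; rewrite (adjoint0 (adjoint_iter n AA)) nrm0.
- move=> x y [C xC] [C' yC]; exists (C + C') => n.
  by rewrite (adjointD (adjoint_iter n AA)); apply: le_trans (nrmD _ _) _; rewrite lerD.
- move=> r x [C xC]; exists (`|r| * C) => n.
  by rewrite (adjointZ _ (adjoint_iter n AA)) nrmZr ler_wpM2l.
- move=> u l uE ul; exists (nrm l) => n; have [M M0 hM] := bdd_iter n bA.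
  rewrite -subr_le0.
  apply: (tends_le (f := fun x => nrm (iter n A x) - nrm x) (K := M + 1)) ul _.
    move=> x y; have := nrm_lip (iter n A x) (iter n A y).
    have := nrm_lip y x; rewrite -(nrmN (y - x)) opprB.
    rewrite -(adjointB (adjoint_iter n AA)); have := hM (x - y).
    move: (nrm (iter n A (x - y))) (nrm (x - y)) => p q h1 h2 h3; lra.
  by move=> k; rewrite subr_le0; exact: power_bounded_le.
Qed.

(** Let [t_n] solve [(1 + A + ... + A^n) t_n = u].  Since [A^m] is dominated by the
sum, the limit [w] of [t_n] has a bounded orbit, hence [<t_n, u>] tends to
[<w, u> = 0].  The telescoping identity [(A - 1) u = A^(n+1) t_n - t_n] then
gives [<(A - 1) u, u> >= - <t_n, u>]. *)
Lemma orth_power_bounded_ge u : (forall e, power_bounded e -> ip u e = 0) ->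
  ip u u <= ip (A u) u.
Proof.
move=> uO; have [t [w [tu tw]]] := geom_inv_cvg u.
have wE : power_bounded w.
  exists (nrm u) => m; have [M M0 hM] := bdd_iter m bA.
  have tw' : tends (fun n => t (n + m)%N) w.
    move=> e /tw[N hN]; exists N => n Nn; apply: hN.
    by rewrite (leq_trans Nn)// leq_addr.
  apply: (tends_le (f := fun x => nrm (iter m A x)) (K := M)) tw' _ => [x y|n].
    apply: le_trans (nrm_lip _ (iter m A y)) _.
    by rewrite -(adjointB (adjoint_iter m AA)) lerD2l.
  by rewrite -(tu (n + m)%N); apply: nrm_iter_le_geom; rewrite leq_addl.
have low n : ip u u - ip (A u) u <= ip (t n) u.
  have := geom_telescope n (t n); rewrite tu => /(congr1 (fun z => ip z u)).
  rewrite !ipDl => h.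
  have : 0 <= ip (iter n.+1 A (t n)) u.
    by rewrite -[X in ip _ X](tu n); exact: cone_ip_ge0 (cone_iter _) (cone_geom _).
  by move: h; move: (ip (iter n.+1 A (t n)) u) => q h1 h2; lra.
have lim : (fun n => ip (t n) u) @ \oo --> (0 : R).
  by rewrite -(uO w wE) ipC; exact: tends_ip.
rewrite -subr_le0; apply: (ler_cvg_to (cvg_cst (ip u u - ip (A u) u)) lim).
by near=> n; exact: low.
Unshelve. all: by end_near. Qed.

(** The spectral projection of [[0, 1]]; any bounded operator commuting with [A]
preserves boundedness of orbits, hence commutes with the projection. *)
Lemma positive_cut : exists P, [/\ orth_proj P,
  forall B B', adjoint B B' -> bdd B -> (forall x, B (A x) = A (B x)) ->
    forall x, P (B x) = B (P x),
  forall x, ip (A (P x)) (P x) <= ip (P x) (P x) &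
  forall x, ip (x - P x) (x - P x) <= ip (A (x - P x)) (x - P x)].
Proof.
have [P [PP EP PO PB]] := exists_proj power_bounded_closed.
have inv B B' : adjoint B B' -> bdd B -> (forall x, B (A x) = A (B x)) ->
    forall x, power_bounded x -> power_bounded (B x).
  move=> BB' [M M0 hM] BA x [C xC]; exists (M * C) => n.
  have -> : iter n A (B x) = B (iter n A x).
    by elim: n => // n IH; rewrite !iterS IH BA.
  by apply: le_trans (hM _) _; rewrite ler_wpM2l.
exists P; split=> //.
- move=> B B' BB' bB BA; apply: (PB _ _ BB'); first exact: inv BB' bB BA.
  apply: (inv _ _ (adjoint_sym BB') (adjoint_bdd BB' bB)) => x; apply: ip_inj => z.
  by rewrite (adjoint_sym BB') !AA (adjoint_sym BB') BA.
- move=> x; apply: le_trans (ip_le_nrm _ _) _; rewrite ip_sq expr2.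
  by rewrite ler_wpM2r ?nrm_ge0//; exact: (power_bounded_le 1 (EP x)).
- by move=> x; apply: orth_power_bounded_ge => e; exact: PO.
Qed.

End PositiveCut.

(** * Cutting a self-adjoint operator *)

Section SpectralCut.
Variables (R : realType) (H : hilbertType R) (A : H -> H).
Hypotheses (AA : adjoint A A) (bA : bdd A).

(** Shift and scale: [A <= a] exactly when [(A + M) / (a + M) <= 1], and [A + M]
is positive for large [M]. *)
Lemma spectral_cut (a : R) : exists P, [/\ orth_proj P,
  forall B B', adjoint B B' -> bdd B -> (forall x, B (A x) = A (B x)) ->
    forall x, P (B x) = B (P x),
  forall x, ip (A (P x)) (P x) <= a * ip (P x) (P x) &
  forall x, a * ip (x - P x) (x - P x) <= ip (A (x - P x)) (x - P x)].
Proof.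
have [K K0 hK] := bA; pose M := K + `|a| + 1.
have aM : 0 < a + M.
  by have := ler_norm (- a); rewrite normrN /M => h; lra.
pose s := (a + M)^-1; have s0 : 0 < s by rewrite invr_gt0.
pose S x := s%:C *: (A x + M%:C *: x).
have SE x y : ip (S x) y = s * (ip (A x) y + M * ip x y).
  by rewrite ipZl ipDl ipZl.
have SS : adjoint S S.
  by move=> x y; rewrite SE (ipC x (S y)) SE AA (ipC x) (ipC x).
have bS : bdd S by apply: bddZ; apply: bddD => //; apply: bddZ; exact: bdd_id.
have pS x : 0 <= ip (S x) x.
  rewrite SE; apply: mulr_ge0; first exact: ltW.
  have := ip_le_nrm (- A x) x.
  rewrite ipNl nrmN => h; have h2 : nrm (A x) * nrm x <= K * ip x x.
    by rewrite ip_sq expr2 mulrA ler_wpM2r ?nrm_ge0.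
  have h3 : 0 <= (`|a| + 1) * ip x x by rewrite mulr_ge0 ?ip_ge0 ?addr_ge0.
  by rewrite /M; lra.
have [P [PP PB Ple Pge]] := positive_cut SS bS pS.
have sE : s * (a + M) = 1 by rewrite mulVf ?gt_eqF.
exists P; split=> //.
- move=> B B' BB' bB BA; apply: (PB _ _ BB' bB) => x.
  by rewrite /S (adjointZ _ BB') (adjointD BB') (adjointZ _ BB') BA.
- move=> x; have := Ple x; rewrite SE -(ler_pM2l aM) mulrA (mulrC _ s) sE mul1r.
  by rewrite (mulrDl a M) lerD2r.
- move=> x; have := Pge x; rewrite SE -(ler_pM2l aM) mulrA (mulrC _ s) sE mul1r.
  by rewrite (mulrDl a M) lerD2r.
Qed.

End SpectralCut.

(** * Spectral projections of a commuting pair *)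

Section CommutingPair.
Variables (R : realType) (H : hilbertType R) (A1 A2 : H -> H).
Hypotheses (AA1 : adjoint A1 A1) (AA2 : adjoint A2 A2).
Hypotheses (bA1 : bdd A1) (bA2 : bdd A2).
Hypothesis A12 : forall x, A1 (A2 x) = A2 (A1 x).
Hypothesis A1i : forall x, A1 ('i *: x) = 'i *: A1 x.
Hypothesis A2i : forall x, A2 ('i *: x) = 'i *: A2 x.
Implicit Types (x y z u v : H) (B G P : H -> H) (a b c r : R).

(** The self-adjoint operators commuting with the whole commutant of [A1] and
[A2].  They commute with one another, and they contain the spectral projections
of each of their members, so projections obtained by successive cuts can be
multiplied freely. *)
Record bicommutant B : Prop := Bicommutant {
  bic_adjoint : adjoint B B;
  bic_bdd : bdd B;
  bic_comm : forall C C', adjoint C C' -> bdd C ->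
    (forall x, C (A1 x) = A1 (C x)) -> (forall x, C (A2 x) = A2 (C x)) ->
    forall x, B (C x) = C (B x) }.

Lemma bic_fst : bicommutant A1.
Proof. by split=> // C C' _ _ h1 h2 x; rewrite h1. Qed.

Lemma bic_snd : bicommutant A2.
Proof. by split=> // C C' _ _ h1 h2 x; rewrite h2. Qed.

Lemma bicC1 B x : bicommutant B -> B (A1 x) = A1 (B x).
Proof. by move=> bB; apply: (bic_comm bB AA1 bA1). Qed.

Lemma bicC2 B x : bicommutant B -> B (A2 x) = A2 (B x).
Proof. by move=> bB; apply: (bic_comm bB AA2 bA2). Qed.

Lemma bicC B C x : bicommutant B -> bicommutant C -> B (C x) = C (B x).
Proof.
move=> bB bC; apply: (bic_comm bB (bic_adjoint bC) (bic_bdd bC)) => z.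
- exact: bicC1.
- exact: bicC2.
Qed.

Lemma bicD B C : bicommutant B -> bicommutant C ->
  bicommutant (fun x => B x + C x).
Proof.
move=> [aB bB cB] [aC bC cC]; split; last 1 first.
- move=> D D' DD' bD D1 D2 x.
  by rewrite (cB _ _ DD')// (cC _ _ DD')// (adjointD DD').
- by move=> x y; rewrite ipDl ipDr aB aC.
- exact: bddD.
Qed.

Lemma bicZ r B : bicommutant B -> bicommutant (fun x => r%:C *: B x).
Proof.
move=> [aB bB cB]; split; last 1 first.
- move=> D D' DD' bD D1 D2 x.
  by rewrite (cB _ _ DD')// (adjointZ _ DD').
- by move=> x y; rewrite ipZl ipZr aB.
- exact: bddZ.
Qed.

Lemma bic_id : bicommutant id.
Proof. by split=> //; exact: bdd_id. Qed.

Lemma bic_comp B C : bicommutant B -> bicommutant C -> bicommutant (B \o C).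
Proof.
move=> bB bC; split.
- move=> x y /=; rewrite (bic_adjoint bB) (bic_adjoint bC).
  by rewrite (bicC y bC bB).
- exact: bdd_comp (bic_bdd bB) (bic_bdd bC).
- move=> D D' DD' bD D1 D2 x /=.
  by rewrite (bic_comm bC DD')// (bic_comm bB DD').
Qed.

Definition shift B c x := B x - c%:C *: x.

Lemma shiftE B c : shift B c = fun x => B x + (- c)%:C *: x.
Proof. by apply/funext => x; rewrite /shift rmorphN scaleNr. Qed.

Lemma bic_shift B c : bicommutant B -> bicommutant (shift B c).
Proof. by move=> bB; rewrite shiftE; apply: bicD => //; apply/bicZ/bic_id. Qed.

Definition spectral_proj P := bicommutant P /\ forall x, P (P x) = P x.

Lemma sproj_orth P : spectral_proj P -> orth_proj P.
Proof. by case=> bP PI; split=> //; exact: bic_adjoint bP. Qed.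

Lemma sprojC P : spectral_proj P -> spectral_proj (fun x => x - P x).
Proof.
move=> PP; have [PA PI] := projC (sproj_orth PP); split=> //.
rewrite (_ : (fun _ => _) = fun x => id x + (-1)%:C *: P x).
  by apply: bicD bic_id _; apply/bicZ/PP.1.
by apply/funext => x; rewrite rmorphN1 scaleN1r.
Qed.

Lemma sproj_comp P G : spectral_proj P -> spectral_proj G ->
  spectral_proj (P \o G).
Proof.
move=> PP GG; split; first exact: bic_comp PP.1 GG.1.
move=> x; rewrite /= (bicC (G x) GG.1 PP.1) PP.2.
by rewrite GG.2.
Qed.

Lemma bic_cut B c : bicommutant B -> exists P, [/\ spectral_proj P,
  forall v, P v = v -> ip (B v) v <= c * ip v v &
  forall v, P v = 0 -> c * ip v v <= ip (B v) v].
Proof.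
move=> bB; have [P [PP PB Ple Pge]] := spectral_cut (bic_adjoint bB) (bic_bdd bB) c.
exists P; split.
- split; last exact: proj_idem PP.
  split; [exact: proj_adjoint PP|exact: proj_bdd PP|].
  move=> C C' CC' bC C1 C2; apply: (PB _ _ CC' bC) => x.
  by rewrite (bic_comm bB CC').
- by move=> v Pv; have := Ple v; rewrite Pv.
- by move=> v Pv; have := Pge v; rewrite Pv subr0.
Qed.

Lemma shiftZi B c x : (forall z, B ('i *: z) = 'i *: B z) ->
  shift B c ('i *: x) = 'i *: shift B c x.
Proof. by move=> Bi; rewrite /shift scalerBr !scalerA (mulrC 'i) -!scalerA Bi. Qed.

(** The number equals its opposite: move the shift of [A1] to the right, or [i]
and then the shift of [A2] to the left. *)
Lemma cross_term x c d : ip (shift A1 c x) ('i *: shift A2 d x) = 0.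
Proof.
have [a1 _ _] := bic_shift c bic_fst; have [a2 _ _] := bic_shift d bic_snd.
have q1 : ip (shift A1 c x) ('i *: shift A2 d x) =
    ip x ('i *: shift A1 c (shift A2 d x)).
  by rewrite a1 shiftZi.
have q2 : ip (shift A1 c x) ('i *: shift A2 d x) =
    - ip x ('i *: shift A1 c (shift A2 d x)).
  rewrite ipZir -a2 shiftZi//.
  by rewrite (bicC _ (bic_shift d bic_snd) (bic_shift c bic_fst)) ipC.
by have := q1; rewrite q2 => h; lra.
Qed.

Lemma shift_pyth x c d :
  ip (shift A1 c x + 'i *: shift A2 d x) (shift A1 c x + 'i *: shift A2 d x) =
  ip (shift A1 c x) (shift A1 c x) + ip (shift A2 d x) (shift A2 d x).
Proof. by rewrite ip_normD cross_term mul0rn addr0 [X in _ + X]ip_sq nrmZi -ip_sq. Qed.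

Lemma shift_pyth_conj x c d :
  ip (shift A1 c x - 'i *: shift A2 d x) (shift A1 c x - 'i *: shift A2 d x) =
  ip (shift A1 c x) (shift A1 c x) + ip (shift A2 d x) (shift A2 d x).
Proof. by rewrite ip_normB cross_term mul0rn subr0 [X in _ + X]ip_sq nrmZi -ip_sq. Qed.

(** This is [N - (c + i d)] for the normal operator [N = A1 + i A2]. *)
Definition normal_shift c d x := shift A1 c x + 'i *: shift A2 d x.

Lemma normal_shift_adjoint c d :
  adjoint (normal_shift c d) (fun x => shift A1 c x - 'i *: shift A2 d x).
Proof.
move=> x y; rewrite /normal_shift ipDl ipBr ipZil.
rewrite (bic_adjoint (bic_shift c bic_fst)) (bic_adjoint (bic_shift d bic_snd)).
by rewrite shiftZi.
Qed.

Lemma normal_shift_bdd c d : bdd (normal_shift c d).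
Proof.
apply: bddD; first exact: bic_bdd (bic_shift c bic_fst).
have [M M0 hM] := bic_bdd (bic_shift d bic_snd).
by exists M => // x; rewrite nrmZi.
Qed.


(** The adjoint of a normal operator has the same norms, so a lower bound gives
an injective adjoint, hence surjectivity. *)
Lemma approx_eigenvectors c d :
  ~ bijective (normal_shift c d) -> forall e : R, 0 < e ->
  exists2 u, u != 0 & nrm (normal_shift c d u) < e * nrm u.
Proof.
move=> nb e e0; apply: contrapT => h; apply: nb.
have NA := normal_shift_adjoint c d.
have below x : e * nrm x <= nrm (normal_shift c d x).
  have [->|x0] := eqVneq x 0; first by rewrite nrm0 mulr0 nrm_ge0.
  by rewrite leNgt; apply/negP => hx; apply: h; exists x.
have eq0 x : nrm (normal_shift c d x) <= 0 -> x = 0.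
  move=> hx; apply/nrm0_eq0/le_anti; rewrite nrm_ge0 andbT.
  by rewrite -(pmulr_rle0 _ e0); apply: le_trans (below x) hx.
have surj := bounded_below_surj NA (normal_shift_bdd c d) e0 below.
have [|g gK] := choice (surj _).
  move=> x gx0; apply: eq0.
  apply: le_trans (_ : _ <= nrm (0 : H)) _; last by rewrite nrm0.
  by apply: ip_le; rewrite shift_pyth -shift_pyth_conj gx0.
exists g => // x; apply/eqP; rewrite -subr_eq0; apply/eqP/eq0.
by rewrite (adjointB NA) gK subrr nrm0.
Qed.

(** Cut [(A1 - c)^2 + (A2 - d)^2] at [r^2].  An approximate eigenvector cannot be
killed by the projection, since on the kernel of the projection the operator
[N - (c + i d)] is bounded below by [r]. *)
Lemma disc_proj c d r : 0 < r -> ~ bijective (normal_shift c d) ->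
  exists P, [/\ spectral_proj P, exists u, P u != 0 &
    forall v, P v = v -> ip (shift A1 c v) (shift A1 c v)
      + ip (shift A2 d v) (shift A2 d v) <= r ^+ 2 * ip v v].
Proof.
move=> r0 /approx_eigenvectors/(_ r r0)[u u0 hu].
have b1 := bic_shift c bic_fst; have b2 := bic_shift d bic_snd.
have [P [PP Ple Pge]] := bic_cut (r ^+ 2) (bicD (bic_comp b1 b1) (bic_comp b2 b2)).
have SE v : ip (shift A1 c (shift A1 c v) + shift A2 d (shift A2 d v)) v =
    ip (shift A1 c v) (shift A1 c v) + ip (shift A2 d v) (shift A2 d v).
  by rewrite ipDl (bic_adjoint b1) (bic_adjoint b2).
exists P; split=> //; last by move=> v /Ple; rewrite /= SE.
exists u; apply/negP => /eqP /Pge; rewrite /= SE -shift_pyth leNgt => /negP; apply.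
rewrite -/(normal_shift c d u) !ip_sq -exprMn ltr_sqr ?nnegrE ?nrm_ge0//.
by rewrite mulr_ge0 ?nrm_ge0 ?(ltW r0).
Qed.

Definition between B G a b := forall v, G v = v ->
  a * ip v v <= ip (B v) v <= b * ip v v.

(** From [0 <= S <= r] to [|S v| <= r |v|]: the nonnegative operators
[S (r - S)^2] and [(r - S) S^2] add up to [r S (r - S)], so [S^2 <= r S]. *)
Lemma between_shift B G a r v : bicommutant B -> spectral_proj G ->
  0 < r -> between B G a (a + r) -> G v = v -> nrm (shift B a v) <= r * nrm v.
Proof.
move=> bB GG r0 BG Gv.
have bS := bic_shift a bB; have SS := bic_adjoint bS.
have pos w : G w = w -> 0 <= ip (shift B a w) w <= r * ip w w.
  by move=> /BG; rewrite ipBl ipZl mulrDl subr_ge0 lerBlDl.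
have GS w : G w = w -> G (shift B a w) = shift B a w.
  by move=> Gw; rewrite (bicC w GG.1 bS) Gw.
move: (shift B a) bS SS pos GS => S bS SS pos GS.
have /andP[_ h1] := pos v Gv.
have /andP[_ h2] := pos (S v) (GS v Gv).
have /andP[h3 _] : 0 <= ip (S (r%:C *: v - S v)) (r%:C *: v - S v) <=
    r * ip (r%:C *: v - S v) (r%:C *: v - S v).
  apply: pos; rewrite (adjointB (bic_adjoint GG.1)).
  by rewrite (adjointZ _ (bic_adjoint GG.1)) Gv GS.
move: h3; rewrite (adjointB SS) (adjointZ _ SS) !ipBl !ipBr !ipZl !ipZr.
rewrite (SS (S v) v) => h3.
have h4 : ip (S v) (S v) <= r * ip (S v) v.
  by rewrite -(ler_pM2l r0); lra.
apply: ip_leM; first exact: ltW.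
apply: le_trans h4 _; rewrite expr2 -mulrA.
by rewrite ler_wpM2l ?(ltW r0).
Qed.

Lemma between_shiftW B G a r c v : bicommutant B -> spectral_proj G ->
  0 < r -> between B G a (a + r) -> a <= c <= a + r -> G v = v ->
  nrm (shift B c v) <= (r *+ 2) * nrm v.
Proof.
move=> bB GG r0 BG /andP[ac ca] Gv.
have -> : shift B c v = shift B a v - (c - a)%:C *: v.
  by rewrite /shift rmorphB scalerBl opprB addrA subrK.
apply: le_trans (nrmB _ _) _; rewrite mulr2n mulrDl lerD//.
  exact: (between_shift bB GG r0 BG Gv).
by rewrite nrmZr ler_wpM2r ?nrm_ge0// ger0_norm ?subr_ge0// lerBlDl.
Qed.

(** Cut at the midpoint and keep the half that carries more of [y]. *)
Lemma halve B G a r y : bicommutant B -> spectral_proj G -> 0 < r ->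
  between B G a (a + r) -> exists G' a', [/\ spectral_proj G',
    forall v, G' v = v -> G v = v,
    between B G' a' (a' + r / 2), a <= a' <= a + r / 2 &
    ip (G y) (G y) <= ip (G' y) (G' y) *+ 2].
Proof.
move=> bB GG r0 BG.
have [P [PP Ple Pge]] := bic_cut (a + r / 2) bB.
have GP x : G (P x) = P (G x) := bicC x GG.1 PP.1.
have sub Q : (forall x, G (Q x) = Q (G x)) -> forall v, (Q \o G) v = v -> G v = v.
  by move=> GQ v /= <-; rewrite GQ GG.2.
have QQ := sprojC PP.
have GQ x : G (x - P x) = G x - P (G x) by rewrite (adjointB (bic_adjoint GG.1)) GP.
have split_y : ip (G y) (G y) = ip (P (G y)) (P (G y)) +
  ip (G y - P (G y)) (G y - P (G y)) := proj_split (G y) (sproj_orth PP).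
have [le|lt] := leP (ip (G y - P (G y)) (G y - P (G y))) (ip (P (G y)) (P (G y))).
- exists (P \o G), a; split.
  + exact: sproj_comp.
  + exact: sub.
  + move=> v v_fix; have /BG/andP[-> _] := sub _ GP _ v_fix; apply: Ple.
    by rewrite -v_fix /= PP.2.
  + by rewrite lexx lerDl divr_ge0 ?(ltW r0).
  + by rewrite /= split_y; lra.
- exists ((fun x => x - P x) \o G), (a + r / 2); split.
  + exact: sproj_comp.
  + exact: sub.
  + move=> v v_fix; have /BG/andP[_] := sub _ GQ _ v_fix.
    rewrite -addrA -splitr => ->; rewrite andbT; apply: Pge.
    by rewrite -v_fix /= (adjointB (bic_adjoint PP.1)) PP.2 subrr.
  + by rewrite lexx andbT lerDl divr_ge0 ?(ltW r0).
  + by rewrite /= split_y; lra.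
Qed.

(** The range of [G] is a spectral subspace for the square with corner [a + i b]
and side [r]. *)
Record box G a b r : Prop := Box {
  box_proj : spectral_proj G;
  box_gt0 : 0 < r;
  box1 : between A1 G a (a + r);
  box2 : between A2 G b (b + r) }.

Lemma box_quarter G a b r y : box G a b r -> exists G' a' b',
  [/\ box G' a' b' (r / 2), a <= a' <= a + r / 2, b <= b' <= b + r / 2 &
   nrm (G y) <= nrm (G' y) *+ 2].
Proof.
move=> [GG r0 G1 G2].
have [G' [a' [GG' sub' G1' aa' y']]] := halve y bic_fst GG r0 G1.
have G2' : between A2 G' b (b + r) by move=> v /sub'; exact: G2.
have [G'' [b' [GG'' sub'' G2'' bb' y'']]] := halve y bic_snd GG' r0 G2'.
exists G'', a', b'; split=> //.
  split=> //; first by rewrite divr_gt0.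
  by move=> v /sub''; exact: G1'.
rewrite -ler_sqr ?nnegrE ?mulrn_wge0 ?nrm_ge0// -mulr_natl exprMn -!ip_sq.
by lra.
Qed.

Lemma box_normal_shift G a b r c d v : box G a b r -> a <= c <= a + r ->
  b <= d <= b + r -> G v = v -> nrm (normal_shift c d v) <= r *+ 4 * nrm v.
Proof.
move=> [GG r0 G1 G2] hc hd Gv; apply: le_trans (nrmD _ _) _; rewrite nrmZi.
have := between_shiftW bic_fst GG r0 G1 hc Gv.
by have := between_shiftW bic_snd GG r0 G2 hd Gv => h1 h2; lra.
Qed.

Lemma normal_shift_comm c d G x : bicommutant G ->
  G (normal_shift c d x) = normal_shift c d (G x).
Proof.
move=> bG; apply: (bic_comm bG (normal_shift_adjoint c d) (normal_shift_bdd c d)) => z.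
- rewrite /normal_shift (adjointD AA1) A1i.
  by rewrite -!(bicC1 _ (bic_shift _ bic_fst)) -(bicC1 _ (bic_shift d bic_snd)).
- rewrite /normal_shift (adjointD AA2) A2i.
  by rewrite -(bicC2 _ (bic_shift _ bic_fst)) -(bicC2 _ (bic_shift d bic_snd)).
Qed.

(** In a small box around [c + i d] the operator [N - (c + i d)] is small, so
being in the range of its square bounds the component in the box. *)
Lemma box_square_le G a b r c d y h : box G a b r -> a <= c <= a + r ->
  b <= d <= b + r -> normal_shift c d (normal_shift c d h) = y ->
  nrm (G y) <= (r *+ 4) ^+ 2 * nrm h.
Proof.
move=> bx hc hd <-; have [GG r0 _ _] := bx.
have fix1 x : G (G x) = G x := GG.2 x.
rewrite !(normal_shift_comm _ _ _ GG.1).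
have r4 : 0 <= r *+ 4 by rewrite mulrn_wge0 ?(ltW r0).
apply: le_trans (box_normal_shift bx hc hd _) _.
  by rewrite !(normal_shift_comm _ _ _ GG.1) fix1.
rewrite expr2 -mulrA ler_wpM2l//.
apply: le_trans (box_normal_shift bx hc hd (fix1 h)) _.
by rewrite ler_wpM2l// proj_nrm//; exact: sproj_orth.
Qed.

(** Iterated bisection, always following a quarter that retains half of the norm
of the component of [y]. *)
Lemma box_orbit G a b r y : box G a b r -> exists Gn an bn,
  [/\ an 0%N = a /\ bn 0%N = b,
    forall n, box (Gn n) (an n) (bn n) (r / 2 ^+ n),
    forall n, an n <= an n.+1 <= an n + r / 2 ^+ n.+1,
    forall n, bn n <= bn n.+1 <= bn n + r / 2 ^+ n.+1 &
    forall n, nrm (G y) <= 2 ^+ n * nrm (Gn n y)].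
Proof.
move=> bx.
pose st := ((H -> H) * R * R * R)%type.
pose isbox (s : st) := box s.1.1.1 s.1.1.2 s.1.2 s.2.
have step (s : st) : exists s' : st, isbox s ->
    [/\ isbox s', s'.2 = s.2 / 2, s.1.1.2 <= s'.1.1.2 <= s.1.1.2 + s.2 / 2,
    s.1.2 <= s'.1.2 <= s.1.2 + s.2 / 2 & nrm (s.1.1.1 y) <= nrm (s'.1.1.1 y) *+ 2].
  have [sb|nsb] := pselect (isbox s); last by exists s.
  have [G' [a' [b' [bx' h1 h2 h3]]]] := box_quarter y sb.
  by exists (G', a', b', s.2 / 2).
have [f fP] := choice step.
pose s n := iter n f (G, a, b, r).
have sb n : isbox (s n).
  by elim: n => [|n /fP[]//]; exact: bx.
have sr n : (s n).2 = r / 2 ^+ n.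
  elim: n => [|n IH]; first by rewrite expr0 divr1.
  have [_ /= -> _ _ _] := fP _ (sb n).
  by rewrite -/(s n) IH exprS invfM mulrA mulrAC.
exists (fun n => (s n).1.1.1), (fun n => (s n).1.1.2), (fun n => (s n).1.2).
have srS n : r / 2 ^+ n.+1 = (s n).2 / 2 by rewrite sr exprS invfM mulrA mulrAC.
split=> // n.
- by have := sb n; rewrite /isbox sr.
- by rewrite srS; have [_ _ h _ _] := fP _ (sb n).
- by rewrite srS; have [_ _ _ h _] := fP _ (sb n).
- elim: n => [|n IH]; first by rewrite expr0 mul1r.
  apply: le_trans IH _; rewrite exprSr -mulrA ler_wpM2l ?exprn_ge0//.
  by have [_ _ _ _ h] := fP _ (sb n); rewrite mulr_natl.
Qed.

(** At the limit point of the bisection, [|G y| <= 2^n |G_n y|] and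
[|G_n y| <= (4 r / 2^n)^2 |h|] give [2^n |G y| <= 16 r^2 |h|] for all [n].  No
regularity of [h] in [c] and [d] enters, since a single point is used. *)
Lemma box_no_square_range G a b r y : box G a b r ->
    (forall c d, a <= c <= a + r -> b <= d <= b + r ->
      exists h, normal_shift c d (normal_shift c d h) = y) ->
  G y = 0.
Proof.
move=> bx hy; have r0 := box_gt0 bx.
have [Gn [an [bn [[a0 b0] bxn han hbn hG]]]] := box_orbit y bx.
have [c cP] := nested_point r0 han; have [d dP] := nested_point r0 hbn.
have [h hE] : exists h, normal_shift c d (normal_shift c d h) = y.
  apply: hy; first by have := cP 0%N; rewrite a0 expr0 divr1.
  by have := dP 0%N; rewrite b0 expr0 divr1.
apply/nrm0_eq0/le_anti; rewrite nrm_ge0 andbT.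
apply: (@le0_mul_exp2 _ _ (16 * r ^+ 2 * nrm h)) => n.
have p0 : 0 < 2 ^+ n :> R by rewrite exprn_gt0.
have square := box_square_le (bxn n) (cP n) (dP n) hE.
apply: (@le_trans _ _ (2 ^+ n * (((r / 2 ^+ n) *+ 4) ^+ 2 * nrm h) * 2 ^+ n)).
  by rewrite ler_pM2r//; apply: le_trans (hG n) _; rewrite ler_pM2l.
rewrite le_eqVlt; apply/orP; left; apply/eqP.
by field; rewrite expf_neq0.
Qed.

Lemma disc_box P c d r : 0 < r -> spectral_proj P ->
    (forall v, P v = v -> ip (shift A1 c v) (shift A1 c v)
      + ip (shift A2 d v) (shift A2 d v) <= r ^+ 2 * ip v v) ->
  box P (c - r) (d - r) (r *+ 2).
Proof.
move=> r0 PP hP.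
have aux B e v : ip (shift B e v) (shift B e v) <= r ^+ 2 * ip v v ->
    (e - r) * ip v v <= ip (B v) v <= (e - r + r *+ 2) * ip v v.
  move=> hB; have : `|ip (shift B e v) v| <= r * ip v v.
    apply: le_trans (cauchy_schwarz _ _) _; rewrite [X in _ <= _ * X]ip_sq expr2 mulrA.
    by rewrite ler_wpM2r ?nrm_ge0//; apply: ip_leM; first exact: ltW.
  by rewrite ler_norml ipBl ipZl => /andP[h1 h2]; apply/andP; split; lra.
split=> //; first by rewrite mulrn_wgt0.
- move=> v /hP h; apply: aux; apply: le_trans h; rewrite lerDl; exact: ip_ge0.
- move=> v /hP h; apply: aux; apply: le_trans h; rewrite lerDr; exact: ip_ge0.
Qed.

End CommutingPair.

(** * The bounded inverse theorem *)

Section BoundedInverse.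
Variables (R : realType) (X : completeNormedModType R[i]).
Implicit Types (x y z w : X).

(** Steps dominated by the decrements of a nonnegative sequence are summable.  This
covers nested balls, with [e] the radii, and geometric series, with [e] the
remainders. *)
Lemma summable_steps_cvg (u : nat -> X) (e : nat -> R) :
    (forall n, 0 <= e n) -> (forall n, nrm (u n.+1 - u n) <= e n - e n.+1) ->
  exists l, forall n, nrm (l - u n) <= e n.
Proof.
move=> e0 ue.
have step m n : (m <= n)%N -> nrm (u n - u m) <= e m - e n.
  move=> /subnK <-; elim: (n - m)%N => [|k IH]; first by rewrite !subrr nrm0.
  have -> : u (k.+1 + m)%N - u m = (u (k + m).+1 - u (k + m)%N) + (u (k + m)%N - u m).
    by rewrite addSn addrA subrK.
  apply: le_trans (nrmD _ _) _; rewrite addSn.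
  by have := ue (k + m)%N => h; lra.
pose D : set R := range e.
have Dinf : has_inf D.
  by split; [exists (e 0%N); exists 0%N|exists 0 => _ [n _ <-]].
have /nrm_cauchy_tends[l ul] : forall d : R, 0 < d ->
    exists N, forall m n, (N <= m)%N -> (N <= n)%N -> nrm (u m - u n) < d.
  move=> d d0; have d2 : 0 < d / 2 by rewrite divr_gt0.
  have [_ [N _ <-] hN] := inf_adherent d2 Dinf.
  have near n : (N <= n)%N -> nrm (u n - u N) < d / 2.
    move=> Nn; apply: le_lt_trans (step _ _ Nn) _; rewrite ltrBlDl.
    apply: lt_le_trans hN _; rewrite lerD2r; apply: ge_inf Dinf.2 _ _.
    by exists n.
  exists N => m n Nm Nn.
  have -> : u m - u n = (u m - u N) - (u n - u N) by rewrite opprB addrA subrK.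
  by apply: le_lt_trans (nrmB _ _) _; rewrite [d]splitr ltrD ?near.
exists l => n; apply/ler_addgt0Pr => d d0; have [N hN] := ul d d0.
set k := maxn N n; have kN : (N <= k)%N by exact: leq_maxl.
have kn : (n <= k)%N by exact: leq_maxr.
have -> : l - u n = (u k - u n) - (u k - l) by rewrite opprB [RHS]addrC addrA subrK.
apply: le_trans (nrmB _ _) _; apply: lerD; last exact: ltW (hN k kN).
by apply: le_trans (step _ _ kn) _; rewrite lerBlDr lerDl.
Qed.

Variables (S : X -> X) (K : R).
Hypotheses (SB : {morph S : x y / x - y}).
Hypotheses (SZ : forall r : R, {morph S : x / r%:C *: x}).
Hypotheses (K0 : 0 <= K) (SK : forall x, nrm (S x) <= K * nrm x).
Hypotheses (Ssurj : forall z, exists x, S x = z) (Sinj : injective S).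

(** Baire's argument.  If the images of all balls were nowhere dense, one could
choose nested balls, the n-th avoiding the image of the ball of radius [n]; the
common point would have no preimage. *)
Lemma dense_image_of_ball : exists (n : nat) (z0 : X) (e : R), 0 < e /\
  forall z, nrm (z - z0) < e -> forall d : R, 0 < d ->
    exists2 x, nrm x <= n%:R & nrm (S x - z) < d.
Proof.
apply: contrapT => hno.
have step (s : nat * X * R) : exists t : X * R, 0 < s.2 ->
    [/\ 0 < t.2, nrm (t.1 - s.1.2) <= s.2 - t.2 &
      forall w, nrm (w - t.1) <= t.2 -> forall x, nrm x <= s.1.1%:R -> S x <> w].
  case: s => [[n z] e] /=; have [e0|ne0] := pselect (0 < e); last by exists (z, e).
  apply: contrapT => hn; apply: hno; exists n, z, e; split=> // z' zz' d d0.
  apply: contrapT => hx; apply: hn; pose t := Num.min (e - nrm (z' - z)) (d / 2).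
  have t0 : 0 < t by rewrite lt_min subr_gt0 zz' divr_gt0.
  exists (z', t) => _; split=> //=; first by rewrite lerBrDr -lerBrDl ge_min lexx.
  move=> w wz x xn Sx; apply: hx; exists x => //; rewrite Sx.
  apply: le_lt_trans wz _; apply: (@le_lt_trans _ _ (d / 2)).
    by rewrite ge_min lexx orbT.
  by rewrite ltr_pdivrMr// ltr_pMr// ltr1n.
have [f fP] := choice step.
pose s := fix s n : X * R := if n is m.+1 then f (m, (s m).1, (s m).2) else (0, 1).
have s0 n : 0 < (s n).2.
  elim: n => [|n IH] /=; first exact: ltr01.
  by have [] := fP (n, (s n).1, (s n).2) IH.
have [w wP] := @summable_steps_cvg (fun n => (s n).1) (fun n => (s n).2)
  (fun n => ltW (s0 n)) (fun n => let: And3 _ h _ := fP (n, (s n).1, (s n).2) (s0 n) in h).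
have [x xw] := Ssurj w.
have := archi_boundP (nrm_ge0 x); set n := Num.bound _ => /ltW xn.
by have [_ _ /(_ w (wP n.+1) x xn)] := fP (n, (s n).1, (s n).2) (s0 n).
Qed.

(** Subtracting two approximations moves the centre [z0] to 0, and scaling
reaches every [z]. *)
Lemma approx_preimage : exists2 L : R, 0 <= L & forall z (d : R), 0 < d ->
  exists2 x, nrm x <= L * nrm z & nrm (S x - z) < d.
Proof.
have [n [z0 [e [e0 he]]]] := dense_image_of_ball.
exists (n%:R * 4 / e); first by rewrite divr_ge0 ?mulr_ge0 ?(ltW e0).
move=> z d d0; have [->|z_neq0] := eqVneq z 0.
  by exists 0; rewrite ?nrm0 ?mulr0// -[X in S X](subrr 0) SB !subrr nrm0.
have nz : 0 < nrm z.
  rewrite lt0r nrm_ge0 andbT; apply: contra z_neq0 => /eqP h.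
  by rewrite (nrm0_eq0 h).
pose t := e / (2 * nrm z); have t0 : 0 < t by rewrite divr_gt0 ?mulr_gt0.
have dt : 0 < t * d / 2 by apply: divr_gt0 => //; exact: mulr_gt0.
have [x1 x1n x1d] : exists2 x, nrm x <= n%:R &
    nrm (S x - (z0 + t%:C *: z)) < t * d / 2.
  apply: he dt; rewrite addrAC subrr add0r nrmZr (gtr0_norm t0).
  rewrite /t invfM mulrA divfK ?gt_eqF//.
  by rewrite ltr_pdivrMr// ltr_pMr// ltr1n.
have [x2 x2n x2d] : exists2 x, nrm x <= n%:R & nrm (S x - z0) < t * d / 2.
  by apply: he dt; rewrite subrr nrm0.
exists (t^-1%:C *: (x1 - x2)).
  rewrite nrmZr gtr0_norm ?invr_gt0//.
  apply: (@le_trans _ _ (t^-1 * (n%:R + n%:R))).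
    rewrite ler_wpM2l ?invr_ge0 ?(ltW t0)//.
    by apply: le_trans (nrmB _ _) _; exact: lerD.
  rewrite le_eqVlt; apply/orP; left; apply/eqP; rewrite /t.
  by field; rewrite !gt_eqF.
rewrite SZ SB -[z in _ - z](scale1r z) -(rmorph1 (real_complex R)).
rewrite -[X in X%:C *: z](@mulVf _ t) ?gt_eqF// rmorphM -scalerA -scalerBr.
rewrite nrmZr gtr0_norm ?invr_gt0// mulrC ltr_pdivrMr//.
have -> : S x1 - S x2 - t%:C *: z = (S x1 - (z0 + t%:C *: z)) - (S x2 - z0).
  by rewrite opprB [z0 + _]addrC opprD !addrA subrK addrAC.
apply: le_lt_trans (nrmB _ _) _.
by rewrite mulrC [X in _ < X]splitr ltrD.
Qed.

(** Successive approximation: correct the current preimage [p] by an approximate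
preimage of the residue [z - S p], which halves the residue each time. *)
Theorem bounded_inverse : exists2 c : R, 0 < c & forall x, c * nrm x <= nrm (S x).
Proof.
have [L L0 hL] := approx_preimage.
suff key z : exists2 x, S x = z & nrm x <= L * 2 * nrm z.
  have L1 : 0 < L * 2 + 1 by rewrite ltr_wpDl// mulr_ge0.
  exists (L * 2 + 1)^-1; first by rewrite invr_gt0.
  move=> x; have [y /Sinj -> hy] := key (S x); rewrite mulrC ler_pdivrMr//.
  by apply: le_trans hy _; rewrite mulrC ler_wpM2l ?nrm_ge0// lerDl.
have step p : exists q, nrm (q - p) <= L * nrm (z - S p) /\
    nrm (z - S q) <= nrm (z - S p) / 2.
  have [r0|r0] := eqVneq (nrm (z - S p)) 0.
    by exists p; rewrite subrr nrm0 r0 mulr0 mul0r.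
  have r1 : 0 < nrm (z - S p) / 2 by rewrite divr_gt0// lt0r r0 nrm_ge0.
  have [x xL xd] := hL (z - S p) _ r1; exists (p + x).
  rewrite addrAC subrr add0r; split=> //; apply: ltW; apply: le_lt_trans xd.
  have -> : S (p + x) = S p + S x.
    have S0 : S 0 = 0 by rewrite -[X in S X](subrr 0) SB subrr.
    by rewrite -[x in S (p + x)]opprK SB -[- x]add0r SB S0 sub0r opprK.
  by rewrite opprD addrA -nrmN opprB.
have [f fP] := choice step; pose p n := iter n f 0.
have res n : nrm (z - S (p n)) <= nrm z / 2 ^+ n.
  elim: n => [|n IH].
    by rewrite /p/= -[X in S X](subrr 0) SB !subrr subr0 expr0 divr1.
  apply: le_trans (fP (p n)).2 _; rewrite exprSr invfM mulrA.
  by rewrite ler_wpM2r.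
have e0 n : 0 <= L * 2 * nrm z / 2 ^+ n.
  by rewrite divr_ge0 ?mulr_ge0 ?nrm_ge0 ?exprn_ge0.
have [n|x xP] := @summable_steps_cvg p (fun n => L * 2 * nrm z / 2 ^+ n) e0.
  apply: le_trans (fP (p n)).1 _.
  apply: (@le_trans _ _ (L * (nrm z / 2 ^+ n))); first by rewrite ler_wpM2l.
  rewrite le_eqVlt; apply/orP; left; apply/eqP; rewrite exprS.
  by field; rewrite expf_neq0.
exists x; last by have := xP 0%N; rewrite /p/= subr0 expr0 divr1.
apply/esym/eqP; rewrite -subr_eq0; apply/eqP/nrm0_eq0/le_anti.
rewrite nrm_ge0 andbT; apply: (@le0_mul_exp2 _ _ (nrm z + K * (L * 2 * nrm z))) => n.
have p0 : 0 < 2 ^+ n :> R by rewrite exprn_gt0.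
rewrite -ler_pdivlMr// mulrDl.
have -> : z - S x = (z - S (p n)) - S (x - p n) by rewrite SB opprB addrA subrK.
apply: le_trans (nrmB _ _) _; apply: lerD; first exact: res.
by apply: le_trans (SK _) _; rewrite -(mulrA K) ler_wpM2l.
Qed.

End BoundedInverse.

(** * Normal operators and the spectrum *)

Lemma bounded_op_nrm (R : realType) (V W : normedModType R[i]) (f : V -> W) :
  bounded_op f -> exists2 M : R, 0 <= M & forall x, nrm (f x) <= M * nrm x.
Proof.
move=> [M hM]; exists `|complex.Re M| => // x.
have := hM x; rewrite !nrmE lecE => /andP[_ /=].
case: (M) => p q /=; rewrite mulr0 subr0 => h; apply: le_trans h _.
by rewrite ler_wpM2r ?nrm_ge0// ler_norm.
Qed.

(** [A1 = (N + N') / 2] and [A2 = (N - N') / 2i], where [1 / i = - i]. *)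
Lemma normal_parts (R : realType) (H : hilbertType R) (N : {linear H -> H}) :
    bounded_op N -> normal_op N ->
  exists A1 A2 : H -> H, [/\ adjoint A1 A1 /\ adjoint A2 A2,
    bdd A1 /\ bdd A2,
    forall x, A1 (A2 x) = A2 (A1 x),
    (forall x, A1 ('i *: x) = 'i *: A1 x) /\
      (forall x, A2 ('i *: x) = 'i *: A2 x) &
    forall c d x, normal_shift A1 A2 c d x = N x - (c%:C + 'i * d%:C) *: x].
Proof.
move=> /bounded_op_nrm[M M0 hM] [N' NN' cN].
have bN : bdd N by exists M.
have aN : adjoint N N' by move=> x y; rewrite /ip NN'.
have aN' := adjoint_sym aN; have bN' := adjoint_bdd aN bN.
have N'i x : N' ('i *: x) = 'i *: N' x.
  by apply: ip_inj => z; rewrite aN' !ipZil -linearZ/= aN'.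
have Ni x : N ('i *: x) = 'i *: N x by rewrite linearZ.
have cNN x : N (N' x) = N' (N x) := cN x.
pose h : R := 2^-1.
exists (fun x => h%:C *: (N x + N' x)), (fun x => h%:C *: ('i *: (N' x - N x))).
have sw (r : R) (x : H) : r%:C *: ('i *: x) = 'i *: (r%:C *: x).
  by rewrite !scalerA mulrC.
split.
- split=> x y; rewrite !ipZl !ipZr; first by rewrite ipDl ipDr aN aN' addrC.
  by rewrite ipZil ipBl aN aN' linearZ/= N'i scalerBr ipBr opprB.
- split; apply: bddZ; first exact: bddD.
  have [K K0 hK] : bdd (fun x => N' x - N x).
    have [K K0 hK] := bN'; exists (K + M); first exact: addr_ge0.
    by move=> x; apply: le_trans (nrmB _ _) _; rewrite mulrDl lerD.
  by exists K => // x; rewrite nrmZi.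
- move=> x; rewrite !(adjointZ _ aN) !(adjointZ _ aN') !N'i !Ni.
  rewrite !(adjointB aN) !(adjointB aN') !(adjointD aN) !(adjointD aN') cNN.
  rewrite -!scalerDr -!scalerBr -sw; congr (_ *: (_ *: (_ *: _))).
  by rewrite opprD addrACA.
- split=> x; first by rewrite Ni N'i -scalerDr sw.
  by rewrite Ni N'i -scalerBr sw.
- have parts x : h%:C *: (N x + N' x) + 'i *: (h%:C *: ('i *: (N' x - N x))) = N x.
    rewrite -(sw h) scalerA -expr2 sqr_i scaleN1r -scalerDr opprB addrACA subrr addr0.
    rewrite -mulr2n -scaler_nat scalerA -(rmorph_nat (real_complex R)) -rmorphM.
    by rewrite mulVf// scale1r.
  move=> c d x; rewrite /normal_shift /shift -[in RHS](parts x) scalerBr.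
  by rewrite scalerDl opprD -(scalerA 'i d%:C) addrACA.
Qed.

(** The square of half-side [r] is the box that [disc_box] puts around the disc of
radius [r]. *)
Lemma notin_closureP (R : realType) (S : set R[i]^o) (l : R[i]^o) :
  ~ closure S l -> exists2 r : R, 0 < r & forall c d : R,
    complex.Re l - r <= c <= complex.Re l - r + r *+ 2 ->
    complex.Im l - r <= d <= complex.Im l - r + r *+ 2 ->
    ~ S (c%:C + 'i * d%:C).
Proof.
move=> ncl; apply: contrapT => hno; apply: ncl => B /nbhs_ballP[e e0 eB].
apply: contrapT => nSB; apply: hno.
have [q q0 eq] := gt0_real_complex e0.
exists (q / 2); first by rewrite divr_gt0.
move=> c d hc hd Scd; apply: nSB; exists (c%:C + 'i * d%:C); split=> //.
apply: eB; rewrite -ball_normE/= eq normc_def ltcR.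
rewrite -[X in _ < X]gtr0_norm// -sqrtr_sqr ltr_sqrt ?exprn_gt0//.
move: hc hd; case: (l) => a b /=.
have sq (p x h : R) : 0 < h -> p - h <= x <= p - h + h *+ 2 -> (p - x) ^+ 2 <= h ^+ 2.
  move=> h0 /andP[h1 h2]; rewrite -[(p - x) ^+ 2]real_normK ?num_real//.
  by rewrite ler_sqr ?nnegrE ?(ltW h0)// ler_norml; apply/andP; split; lra.
have q2 : 0 < q / 2 by rewrite divr_gt0.
move=> /(sq _ _ _ q2) h1 /(sq _ _ _ q2) h2.
have h3 : 0 < q ^+ 2 by rewrite exprn_gt0.
rewrite !(mul0r, mul1r, mulr0, sub0r, subr0, add0r, addr0).
by apply: le_lt_trans (lerD h1 h2) _; rewrite expr_div_n; lra.
Qed.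

Lemma spectrum_bij (R : realType) (V : lmodType R[i]) (f g : V -> V)
    (l : R[i]) :
  (forall x, g x = f x - l *: x) -> spectrum f l -> ~ bijective g.
Proof.
by move=> gE; rewrite /spectrum/= => nb bg; apply: nb; apply: eq_bij bg _ _ => x.
Qed.

(** Every [y = Phi x] is in the range of [(N - m)^2] for [m] near [l], because
[Phi] intertwines and [T - m] can be inverted twice.  So the disc projection kills
the dense range of [Phi], although it is nonzero and continuous. *)
Lemma spectrum_sub_closure (R : realType) (H : hilbertType R)
    (X : lmodType R[i]) (Phi : {linear X -> H}) (T : {linear X -> X})
    (N : {linear H -> H}) :
  dense (range Phi) -> bounded_op N -> normal_op N -> Phi \o T =1 N \o Phi ->
  spectrum N `<=` closure (spectrum T).
Proof.
move=> dPhi bN nN PhiT l Nl; apply: contrapT => /notin_closureP[r r0 hr].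
have [A1 [A2 [[AA1 AA2] [bA1 bA2] A12 [A1i A2i] NE]]] := normal_parts bN nN.
set c0 := complex.Re l in hr; set d0 := complex.Im l in hr.
have nb : ~ bijective (normal_shift A1 A2 c0 d0).
  by apply: spectrum_bij Nl => x; rewrite NE -complexE.
have [P [PP [u Pu] Pr]] := disc_proj AA1 AA2 bA1 bA2 A12 A1i A2i r0 nb.
have bx := disc_box r0 PP Pr.
have [y /= [Oy [x _ xy]]] : ball u (nrm (P u))%:C `&` range Phi !=set0.
  apply: dPhi; last exact: ball_open.
  exists u; apply: ballxx; rewrite ltcR lt0r nrm_ge0 andbT.
  by apply: contra Pu => /eqP/nrm0_eq0 ->.
have Py : P y = 0.
  apply: (box_no_square_range AA1 AA2 bA1 bA2 A12 A1i A2i bx) => c d hc hd.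
  have [g _ gK] : bijective (fun x => T x - (c%:C + 'i * d%:C) *: x).
    exact: contrapT (hr c d hc hd).
  have tr z :
      normal_shift A1 A2 c d (Phi z) = Phi (T z - (c%:C + 'i * d%:C) *: z).
    rewrite NE [RHS]linearB [in RHS]linearZ/=; congr (_ - _).
    by rewrite -[RHS]/((Phi \o T) z) PhiT.
  by exists (Phi (g (g x))); rewrite !tr !gK.
have oP := sproj_orth PP.
move: Oy; rewrite -ball_normE/= nrmE ltcR ltNge => /negP; apply.
have := proj_nrm (u - y) oP.
by rewrite (adjointB (proj_adjoint oP)) Py subr0.
Qed.

(** The vectors [(N - l)^n P u] decay faster than [Psi] and the lower bound of
[T - l] permit, unless [Psi (P u) = 0]. *)
Lemma spectrum_sub (R : realType) (H : hilbertType R)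
    (X : completeNormedModType R[i]) (Psi : {linear H -> X})
    (T : {linear X -> X}) (N : {linear H -> H}) :
  injective Psi -> bounded_op Psi -> bounded_op T -> bounded_op N ->
  normal_op N -> Psi \o N =1 T \o Psi -> spectrum N `<=` spectrum T.
Proof.
move=> iPsi /bounded_op_nrm[K K0 hK] /bounded_op_nrm[M M0 hM] bN nN PsiN l Nl.
rewrite /spectrum/= => bT.
have [A1 [A2 [[AA1 AA2] [bA1 bA2] A12 [A1i A2i] NE]]] := normal_parts bN nN.
set c0 := complex.Re l; set d0 := complex.Im l.
have nb : ~ bijective (normal_shift A1 A2 c0 d0).
  by apply: spectrum_bij Nl => x; rewrite NE -complexE.
pose S x := T x - l *: x.
have SB : {morph S : x y / x - y}.
  by move=> x y; rewrite /S scalerBr (raddfB T)/= [in LHS]opprD addrACA -opprD.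
have SZ (r : R) : {morph S : x / r%:C *: x}.
  by move=> x; rewrite /S linearZ/= scalerBr !scalerA (mulrC l).
have SK : exists2 L : R, 0 <= L & forall x, nrm (S x) <= L * nrm x.
  exists (M + nrm (l : R[i]^o)); first by rewrite addr_ge0 ?nrm_ge0.
  move=> x; apply: le_trans (nrmB _ _) _; rewrite mulrDl lerD//.
  by rewrite -lecR rmorphM/= -!nrmE normrZ.
have [L L0 hL] := SK.
have [g gS Sg] := bT.
have [q q0 hq] := bounded_inverse SB SZ L0 hL
  (fun z => ex_intro _ (g z) (Sg z)) (can_inj gS).
have q2 : 0 < q / 2 by rewrite divr_gt0.
have [P [PP [u Pu] Pr]] := disc_proj AA1 AA2 bA1 bA2 A12 A1i A2i q2 nb.
have small v : P v = v -> nrm (normal_shift A1 A2 c0 d0 v) <= q / 2 * nrm v.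
  by move=> Pv; apply: ip_leM; [exact: ltW|rewrite shift_pyth// Pr].
have tr v : S (Psi v) = Psi (normal_shift A1 A2 c0 d0 v).
  rewrite NE -complexE [RHS]linearB [in RHS]linearZ/= /S; congr (_ - _).
  by rewrite -[LHS]/((T \o Psi) v) -PsiN.
pose vn n := iter n (normal_shift A1 A2 c0 d0) (P u).
have vP n : P (vn n) = vn n.
  elim: n => [|n IH]; first exact: PP.2.
  by rewrite /vn iterS normal_shift_comm//; [rewrite -/(vn n) IH|exact: PP.1].
have up n : q ^+ n * nrm (Psi (P u)) <= nrm (Psi (vn n)).
  elim: n => [|n IH]; first by rewrite expr0 mul1r.
  rewrite /vn iterS -tr; apply: le_trans (hq _); rewrite exprS -mulrA.
  by rewrite ler_wpM2l ?(ltW q0).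
have down n : nrm (vn n) <= (q / 2) ^+ n * nrm (P u).
  elim: n => [|n IH]; first by rewrite expr0 mul1r.
  rewrite /vn iterS; apply: le_trans (small _ (vP n)) _; rewrite exprS -(mulrA (q / 2)).
  by rewrite ler_wpM2l ?(ltW q2).
have w0 : nrm (Psi (P u)) <= 0.
  apply: (@le0_mul_exp2 _ _ (K * nrm (P u))) => n.
  rewrite -(ler_pM2l (exprn_gt0 n q0)) mulrA.
  apply: (@le_trans _ _ (nrm (Psi (vn n)) * 2 ^+ n)).
    by rewrite ler_wpM2r ?exprn_ge0.
  apply: (@le_trans _ _ (K * ((q / 2) ^+ n * nrm (P u)) * 2 ^+ n)).
    rewrite ler_wpM2r ?exprn_ge0//; apply: le_trans (hK _) _.
    by rewrite ler_wpM2l.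
  rewrite expr_div_n le_eqVlt; apply/orP; left; apply/eqP.
  by field; rewrite expf_neq0.
move/eqP: Pu; apply; apply: iPsi; rewrite linear0; apply/nrm0_eq0/le_anti.
by rewrite w0 nrm_ge0.
Qed.

Theorem corollary2p2 (R : realType) (H : hilbertType R)
    (X : completeNormedModType R[i]) :
  (forall (Phi : {linear X -> H}) (T : {linear X -> X}) (N : {linear H -> H}),
      dense (range Phi) ->
      bounded_op N -> normal_op N ->
      Phi \o T =1 N \o Phi ->
      spectrum N `<=` closure (spectrum T))
  /\
  (forall (Psi : {linear H -> X}) (T : {linear X -> X}) (N : {linear H -> H}),
      injective Psi -> bounded_op Psi ->
      bounded_op T ->
      bounded_op N -> normal_op N ->
      Psi \o N =1 T \o Psi ->
      spectrum N `<=` spectrum T).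
Proof.
split=> [Phi|Psi] T N; [exact: spectrum_sub_closure|exact: spectrum_sub].
Qed.
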